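(* Assume that the family of linear operators $\Pi^h_{\Delta x}(y)$, $y\in\mathcal{D}$, satisfies Assumption $\mathcal{B}(p,c,\mathcal{E})$ (stated in the context). Let $\tilde u^h_n$ be defined by $$\tilde u^h_N(x,y)=f(x,y),\qquad \tilde u^h_n(x,y)=\max\Big\{g(x,y),\ \mathbb{E}\big[\tilde u^h_{n+1}(X^{nh,x,y}_{(n+1)h},Y^{nh,y}_{(n+1)h})\big]\Big\},\quad n=N-1,\dots,0,$$ and let $u^h_n$, for $(x,y)\in\mathcal{X}\times\mathcal{Y}^h_n$, be the approximation $$u^h_N(x,y)=f(x,y),\qquad u^h_n(x,y)=\max\Big\{g(x,y),\ \mathbb{E}\big[\Pi^h_{\Delta x}(y)u^h_{n+1}(\cdot,Y^h_{n+1})(x)\,\big|\,Y^h_n=y\big]\Big\},\quad n=N-1,\dots,0,$$ where either $g=0$ (European case) or $g=f$ (American case). Then there exist $\bar h\in(0,1)$ and $C>0$ such that for every $h<\bar h$ and $|\Delta x|<1$ one has $$\left|\tilde u^h_0(\cdot,Y_0)-u^h_0(\cdot,Y_0)\right|_p\leq CT\,\mathcal{E}(h,\Delta x).$$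
   Context: Let $m,d\in\mathbb{N}^*$, $\mathcal{D}\subseteq\mathbb{R}^d$ a convex domain or the closure of one, $T>0$, $f:\mathbb{R}^m\times\mathcal{D}\to\mathbb{R}$ (payoff; in applications $f\ge 0$). $(X,Y)$ solves $$dX_t=\mu_X(Y_t)dt+\sigma_X(Y_t)dB_t+\gamma_X(Y_t)dH_t,\ X_0\in\mathbb{R}^m,\qquad dY_t=\mu_Y(Y_t)dt+\sigma_Y(Y_t)dW_t,\ Y_0\in\mathcal{D},$$ with $B,W$ independent Brownian motions and $H_t=\sum_{k=1}^{K_t}J_k$ a compound Poisson process independent of them ($K$ Poisson of intensity $\lambda$, $J_k$ i.i.d. with a density; L\'evy density $\nu=\lambda p_{J_1}$). $(X^{t,x,y},Y^{t,y})$ is the solution started from $(x,y)$ at time $t$. Standing assumptions: (1) unique weak solution, staying in $\mathbb{R}^m\times\mathcal{D}$ a.s.; (2) $\mu_X,\mu_Y,\sigma_X$ have polynomial growth, and either $\gamma_X\equiv0$ or $\inf_{y\in\mathcal{D}}|\gamma_X(y)|>0$; (3) $(t,x,y)\mapsto\mathbb{E}[f(X^{t,x,y}_T,Y^{t,y}_T)]$ solves the associated Kolmogorov backward PIDE $\partial_tu+\mathcal{L}u=0$ on $[0,T)\times\mathbb{R}^m\times\mathcal{D}$ with $u(T,\cdot)=f$, $\mathcal{L}$ being the generator of $(X,Y)$. For $N\in\mathbb{N}^*$, $h=T/N$, $(Y^h_n)_{n=0,\dots,N}$ is a Markov chain with state spaces $\mathcal{Y}^h_n\subset\mathcal{D}$,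 $Y^h_0=Y_0$, independent of $B$ and $H$. For a spatial step $\Delta x=(\Delta x_1,\dots,\Delta x_m)\in(0,\infty)^m$, $\mathcal{X}=\{((X_0)_1+i_1\Delta x_1,\dots,(X_0)_m+i_m\Delta x_m):i\in\mathbb{Z}^m\}$; $l_p(\mathcal{X})$ is the space of $\varphi:\mathcal{X}\to\mathbb{R}$ with finite norm $|\varphi|_p=(\sum_{x\in\mathcal{X}}|\varphi(x)|^p\Delta x_1\cdots\Delta x_m)^{1/p}$ if $p<\infty$, $|\varphi|_\infty=\sup_{\mathcal{X}}|\varphi|$; for a linear operator $\Gamma$ on $l_p(\mathcal{X})$, $|\Gamma|_p$ is the operator norm; for $\varphi$ defined on $\mathbb{R}^m$, $|\varphi|_p$ is the norm of its restriction to $\mathcal{X}$. $\|\cdot\|_p$ is the norm of $L^p(\Omega)$. Assumption $\mathcal{B}(p,c,\mathcal{E})$: let $p\in[1,\infty]$, $c=c(y)\geq0$ on $\mathcal{D}$, and $\mathcal{E}=\mathcal{E}(h,\Delta x)\geq0$ with $\lim_{(h,\Delta x)\to0}\mathcal{E}(h,\Delta x)=0$. The linear operators $\Pi^h_{\Delta x}(y):l_p(\mathcal{X})\to l_p(\mathcal{X})$, $y\in\mathcal{D}$, satisfy the assumption if $|\Pi^h_{\Delta x}(y)|_p\leq1+c(y)h$ and, for every $n=0,\dots,N-1$, $$\mathbb{E}\big[\Pi^h_{\Delta x}(Y^h_n)\tilde u^h_{n+1}(\cdot,Y^h_{n+1})(x)\,\big|\,Y^h_n=y\big]=\mathbb{E}\big[\tilde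 u^h_{n+1}(X^{nh,x,y}_{(n+1)h},Y^{nh,y}_{(n+1)h})\big]+\mathcal{R}^h_n(x,y),\quad(x,y)\in\mathcal{X}\times\mathcal{Y}^h_n,$$ where the remainder satisfies: there exist $\bar h<1$ and $C>0$ such that for every $h<\bar h$, $|\Delta x|<1$ and $n\leq N$, $\big\|e^{\sum_{l=1}^nc(Y^h_l)h}|\mathcal{R}^h_n(\cdot,Y^h_n)|_p\big\|_p\leq Ch\,\mathcal{E}(h,\Delta x)$ if $p<\infty$, and $\big\|e^{\sum_{l=1}^nc(Y^h_l)h}|\mathcal{R}^h_n(\cdot,Y^h_n)|_\infty\big\|_1\leq Ch\,\mathcal{E}(h,\Delta x)$ if $p=\infty$. *)

(* Defs.v *)
From HB Require Import structures.
From mathcomp Require Import all_boot all_order all_algebra.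
From mathcomp Require Import all_classical all_reals all_analysis.
Set Implicit Arguments.
Unset Strict Implicit.
Unset Printing Implicit Defensive.
Import Order.TTheory GRing.Theory Num.Theory.
Import numFieldNormedType.Exports.
Local Open Scope classical_set_scope.
Local Open Scope ring_scope.

(** * Euclidean spaces *)

Definition borel_mx_display : measure_display. Proof. exact. Qed.

Section borel_matrix.
Context {R : realType} (a b : nat).
Let borel : set (set 'M[R]_(a, b)) := <<s [set A | open A] >>.
Let borel0 : borel set0. Proof. exact: sigma_algebra0. Qed.
Let borelC A : borel A -> borel (~` A). Proof. exact: sigma_algebraC. Qed.
Let borelU (F : (set 'M[R]_(a, b))^nat) :
  (forall i, borel (F i)) -> borel (\bigcup_i F i).
Proof. exact: sigma_algebra_bigcup. Qed.
HB.instance Definition _ :=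
  @isMeasurable.Build borel_mx_display 'M[R]_(a, b) borel borel0 borelC borelU.
End borel_matrix.

(* The library norm on matrices is the max norm. *)
Definition enorm {R : realType} {a b} (A : 'M[R]_(a, b)) : R :=
  Num.sqrt (\sum_i \sum_j A i j ^+ 2).

Definition is_lebesgue {R : realType} {n}
    (mu : {measure set 'rV[R]_n -> \bar R}) : Prop :=
  forall a b : 'rV[R]_n, (forall i, a 0 i <= b 0 i) ->
    mu [set z | forall i, a 0 i <= z 0 i <= b 0 i] =
    (\prod_i (b 0 i - a 0 i))%:E.

Definition convex_domain_or_closure {R : realType} {d} (D : set 'rV[R]_d) :=
  exists U : set 'rV[R]_d,
    [/\ open U, U !=set0,
        (forall y z (l : R), U y -> U z -> 0 <= l <= 1 ->
           U (l *: y + (1 - l) *: z))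
      & D = U \/ D = closure U].

(** * Processes *)

Section processes.
Context {R : realType} {dO : measure_display} {Om : measurableType dO}.
Variable P : probability Om R.
Implicit Types (G : set (set Om)) (F : R -> set (set Om)) (b phi I : R -> Om -> R).

Definition measurable_wrt G {dS} {S : measurableType dS} (Z : Om -> S) : Prop :=
  forall U : set S, measurable U -> G (Z @^-1` U).

Definition sigma_proc {I : Type} {dS} {S : measurableType dS}
    (D : set I) (Z : I -> Om -> S) : set (set Om) :=
  <<s [set Z i @^-1` U | i in D & U in @measurable dS S] >>.

Definition independent G1 G2 : Prop :=
  forall A1 A2, G1 A1 -> G2 A2 -> P (A1 `&` A2) = (P A1 * P A2)%E.

Definition independent4 G1 G2 G3 G4 : Prop :=
  forall A1 A2 A3 A4, G1 A1 -> G2 A2 -> G3 A3 -> G4 A4 ->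
    P (A1 `&` A2 `&` A3 `&` A4) = (P A1 * P A2 * P A3 * P A4)%E.

Definition filtration F : Prop :=
  [/\ forall s : R, 0 <= s -> sigma_algebra setT (F s),
      forall s : R, 0 <= s -> F s `<=` measurable
    & forall s t : R, 0 <= s -> s <= t -> F s `<=` F t].

(* Convergence to 0 in probability of nonnegative [Z n]; the [A n] avoid
   presupposing that the sets {e <= Z n} are measurable. *)
Definition cvg_proba0 (Z : nat -> Om -> \bar R) : Prop :=
  forall e : R, 0 < e -> exists A : nat -> set Om,
    [/\ forall n, measurable (A n), forall n w, (e%:E <= Z n w)%E -> A n w
      & P (A n) @[n --> \oo] --> 0%E].

Definition brownian F n (B : R -> Om -> 'rV[R]_n) : Prop :=
  [/\ forall w, B 0 w = 0,
      forall w, {within [set s : R | 0 <= s], continuous (B ^~ w)},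
      forall s : R, 0 <= s -> measurable_wrt (F s) (B s)
    & forall s t : R, 0 <= s -> s < t -> forall A, F s A ->
        forall U : 'I_n -> set R, (forall i, measurable (U i)) ->
        P (A `&` [set w | forall i, U i (B t w 0 i - B s w 0 i)]) =
        (P A * \prod_i normal_prob 0 (Num.sqrt (t - s)) (U i))%E].

Definition compound n (K : R -> Om -> nat) (J : nat -> Om -> 'rV[R]_n)
    (s : R) (w : Om) : 'rV[R]_n := \sum_(k < K s w) J k w.

(* [K] and the jumps [J] are independent of one another by [independent4]
   below; independence from the past is required of [K] and [H] jointly. *)
Definition compound_poisson F n (lam : R)
    (leb : {measure set 'rV[R]_n -> \bar R}) (dens : 'rV[R]_n -> R)
    (K : R -> Om -> nat) (J : nat -> Om -> 'rV[R]_n) : Prop :=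
  let H := compound K J in
  [/\ [/\ forall w, K 0 w = 0%N,
          forall w (s t : R), 0 <= s -> s <= t -> (K s w <= K t w)%N
        & forall w (s : R), 0 <= s ->
            exists2 e : R, 0 < e & forall r : R, s <= r < s + e -> K r w = K s w],
      forall (s t : R) k, 0 <= s -> s < t ->
        P [set w | (K t w - K s w)%N = k] = (poisson_pmf (lam * (t - s)) k)%:E,
      [/\ forall k, measurable_fun setT (J k)
        & forall N (U : nat -> set 'rV[R]_n), (forall k, measurable (U k)) ->
            P [set w | forall k, (k < N)%N -> U k (J k w)] =
            (\prod_(k < N) \int[leb]_(z in U k) (dens z)%:E)%E],
      forall s : R, 0 <= s -> measurable_wrt (F s) (K s) /\ measurable_wrt (F s) (H s)
    & forall s t : R, 0 <= s -> s < t ->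
        independent (F s)
          (g_sigma_algebra_preimage
             (fun w => ((K t w - K s w)%N, H t w - H s w)))].

(** ** Ito integral of a scalar integrand *)

(* The process  sum_(j < sp_size) sp_coef j * 1_(]sp_time j, sp_time j.+1]) *)
Record simple_process := SimpleProcess {
  sp_size : nat; sp_time : nat -> R; sp_coef : nat -> Om -> R }.

Definition simple_predictable F (t T : R) (V : simple_process) : Prop :=
  [/\ t <= sp_time V 0, sp_time V (sp_size V) <= T
    & forall j, (j < sp_size V)%N ->
        [/\ sp_time V j <= sp_time V j.+1,
            measurable_wrt (F (sp_time V j)) (sp_coef V j)
          & exists C : R, forall w, `|sp_coef V j w| <= C]].

Definition sp_value V (r : R) (w : Om) : R :=
  \sum_(j < sp_size V) sp_coef V j w * (sp_time V j < r <= sp_time V j.+1)%R%:R.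

Definition sp_integral V b (s : R) (w : Om) : R :=
  \sum_(j < sp_size V) sp_coef V j w *
    (b (Num.min (sp_time V j.+1) s) w - b (Num.min (sp_time V j) s) w).

(* [I] is the continuous version of  s |-> int_t^s phi_r db_r  on [t, T]. *)
Definition ito_integral F b (t T : R) phi I : Prop :=
  {ae P, forall w, {within `[t, T], continuous (I ^~ w)}} /\
  exists V : nat -> simple_process,
  [/\ forall n, simple_predictable F t T (V n),
      cvg_proba0 (fun n w =>
        \int[lebesgue_measure]_(r in `[t, T])
          ((sp_value (V n) r w - phi r w) ^+ 2)%:E)%E
    & forall s, t <= s <= T ->
      cvg_proba0 (fun n w => `|sp_integral (V n) b s w - I s w|%:E)].

End processes.

(** * The jump-diffusion *)

Record coefficients (R : realType) (m d lB lW lH : nat) := Coefficients {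
  mu_X : 'rV[R]_d -> 'rV[R]_m;
  sigma_X : 'rV[R]_d -> 'M[R]_(m, lB);
  gamma_X : 'rV[R]_d -> 'M[R]_(m, lH);
  mu_Y : 'rV[R]_d -> 'rV[R]_d;
  sigma_Y : 'rV[R]_d -> 'M[R]_(d, lW);
  intensity : R;
  jump_leb : {measure set 'rV[R]_lH -> \bar R};
  jump_density : 'rV[R]_lH -> R }.

Record setup (R : realType) (m d lB lW lH : nat) := Setup {
  disp : measure_display;
  Omega : measurableType disp;
  Pr : probability Omega R;
  Filt : R -> set (set Omega);
  Bm : R -> Omega -> 'rV[R]_lB;
  Wm : R -> Omega -> 'rV[R]_lW;
  Kp : R -> Omega -> nat;
  Jp : nat -> Omega -> 'rV[R]_lH;
  Xp : R -> Omega -> 'rV[R]_m;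
  Yp : R -> Omega -> 'rV[R]_d }.

Arguments Bm {R m d lB lW lH} _ _ _.
Arguments Wm {R m d lB lW lH} _ _ _.
Arguments Kp {R m d lB lW lH} _ _ _.
Arguments Jp {R m d lB lW lH} _ _ _.
Arguments Xp {R m d lB lW lH} _ _ _.
Arguments Yp {R m d lB lW lH} _ _ _.
Arguments Filt {R m d lB lW lH} _ _ _.

Section jump_diffusion.
Context {R : realType} {m d lB lW lH : nat}.
Notation coefs := (coefficients R m d lB lW lH).
Notation setup := (setup R m d lB lW lH).
Implicit Types (M : coefs) (S : setup) (D : set 'rV[R]_d).

Definition jump_law_ok M : Prop :=
  [/\ 0 < intensity M, is_lebesgue (jump_leb M),
      measurable_fun setT (jump_density M), forall z, 0 <= jump_density M z
    & (\int[jump_leb M]_z (jump_density M z)%:E = 1)%E].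

Definition driving_noise M S : Prop :=
  [/\ filtration (Filt S),
      brownian (Pr S) (Filt S) (Bm S),
      brownian (Pr S) (Filt S) (Wm S),
      compound_poisson (Pr S) (Filt S) (intensity M) (jump_leb M)
        (jump_density M) (Kp S) (Jp S)
    & independent4 (Pr S)
        (sigma_proc [set s : R | 0 <= s] (Bm S))
        (sigma_proc [set s : R | 0 <= s] (Wm S))
        (sigma_proc [set s : R | 0 <= s] (Kp S))
        (sigma_proc [set: nat] (Jp S))].

Definition jump_time S (k : nat) (w : Omega S) : R :=
  inf [set r : R | 0 <= r /\ (k < Kp S r w)%N].

(* int_]t, s] gamma_X(Y_(r-)) dH_r, with Y_(r-) = Y_r since Y is continuous. *)
Definition jump_integral M S (t s : R) (w : Omega S) : 'rV[R]_m :=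
  \sum_(Kp S t w <= k < Kp S s w)
     Jp S k w *m (gamma_X M (Yp S (jump_time k w) w))^T.

Definition weak_solution M D (t T : R) (x : 'rV[R]_m) (y : 'rV[R]_d) S : Prop :=
  [/\ driving_noise M S,
      forall s, t <= s <= T ->
        measurable_wrt (Filt S s) (Xp S s) /\
        measurable_wrt (Filt S s) (Yp S s),
      forall w : Omega S, {within `[t, T], continuous (fun s => Yp S s w)},
      {ae Pr S, forall w, forall s, t <= s <= T -> D (Yp S s w)}
    & exists (IX : 'I_m -> 'I_lB -> R -> Omega S -> R)
             (IY : 'I_d -> 'I_lW -> R -> Omega S -> R),
      [/\ forall i j, ito_integral (Pr S) (Filt S)
            (fun r w => Bm S r w 0 j) t T
            (fun r w => sigma_X M (Yp S r w) i j) (IX i j),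
          forall i j, ito_integral (Pr S) (Filt S)
            (fun r w => Wm S r w 0 j) t T
            (fun r w => sigma_Y M (Yp S r w) i j) (IY i j),
          {ae Pr S, forall w,
            (forall i, lebesgue_measure.-integrable `[t, T]
               (fun r => (mu_X M (Yp S r w) 0 i)%:E)) /\
            (forall i, lebesgue_measure.-integrable `[t, T]
               (fun r => (mu_Y M (Yp S r w) 0 i)%:E))},
          {ae Pr S, forall w, forall s, t <= s <= T -> forall i,
            Xp S s w 0 i = x 0 i
              + \int[lebesgue_measure]_(r in `[t, s]) mu_X M (Yp S r w) 0 i
              + \sum_j IX i j s w + jump_integral M t s w 0 i}
        & {ae Pr S, forall w, forall s, t <= s <= T -> forall i,
            Yp S s w 0 i = y 0 i
              + \int[lebesgue_measure]_(r in `[t, s]) mu_Y M (Yp S r w) 0 i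
              + \sum_j IY i j s w}]].

(* Equality of the finite-dimensional laws of (X, Y) on [t, T]. *)
Definition same_law (t T : R) S1 S2 : Prop :=
  forall n (s : nat -> R) (U : nat -> set 'rV[R]_m) (V : nat -> set 'rV[R]_d),
    (forall k, t <= s k <= T) ->
    (forall k, measurable (U k)) -> (forall k, measurable (V k)) ->
    Pr S1 [set w | forall k, (k < n)%N ->
      U k (Xp S1 (s k) w) /\ V k (Yp S1 (s k) w)] =
    Pr S2 [set w | forall k, (k < n)%N ->
      U k (Xp S2 (s k) w) /\ V k (Yp S2 (s k) w)].

Definition poly_growth {a b} D (phi : 'rV[R]_d -> 'M[R]_(a, b)) : Prop :=
  exists (C : R) (q : nat), forall y, D y -> enorm (phi y) <= C * (1 + enorm y ^+ q).

(* E[phi(X^(t,x,y)_s, Y^(t,y)_s)], where [S t x y] is the solution started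
   from (x, y) at time t. *)
Definition expect (S : R -> 'rV[R]_m -> 'rV[R]_d -> setup) (t s : R)
    (phi : 'rV[R]_m -> 'rV[R]_d -> R) (x : 'rV[R]_m) (y : 'rV[R]_d) : R :=
  fine ('E_(Pr (S t x y))[fun w => phi (Xp (S t x y) s w) (Yp (S t x y) s w)])%E.

Definition expectable (S : R -> 'rV[R]_m -> 'rV[R]_d -> setup) (t s : R)
    (phi : 'rV[R]_m -> 'rV[R]_d -> R) (x : 'rV[R]_m) (y : 'rV[R]_d) : Prop :=
  (Pr (S t x y)).-integrable setT (fun w => (phi (Xp (S t x y) s w) (Yp (S t x y) s w))%:E).

(** ** Kolmogorov backward equation *)

Definition partial {n} (phi : 'rV[R]_n -> R) (z : 'rV[R]_n) (i : 'I_n) (l : R) :=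
  is_derive (0 : R) (1 : R) (fun r : R => phi (z + r *: delta_mx 0 i)) l.

(* The generator of (X, Y) in terms of the derivatives of v; there is no mixed
   second-order term because B and W are independent. *)
Definition generator M (v : 'rV[R]_m -> 'rV[R]_d -> R)
    (vx : 'rV[R]_m) (vxx : 'M[R]_m) (vy : 'rV[R]_d) (vyy : 'M[R]_d)
    (x : 'rV[R]_m) (y : 'rV[R]_d) : R :=
  \sum_i mu_X M y 0 i * vx 0 i
  + 2^-1 * \tr (sigma_X M y *m (sigma_X M y)^T *m vxx)
  + \sum_i mu_Y M y 0 i * vy 0 i
  + 2^-1 * \tr (sigma_Y M y *m (sigma_Y M y)^T *m vyy)
  + \int[jump_leb M]_z ((v (x + z *m (gamma_X M y)^T) y - v x y)
                        * (intensity M * jump_density M z)).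

(* Classical solution on [0, T) x R^m x D: where t = 0 or y lies on the
   boundary of D, derivatives are understood as continuous extensions. *)
Definition solves_backward_pide M D (T : R)
    (v : R -> 'rV[R]_m -> 'rV[R]_d -> R) : Prop :=
  let Q := [set q : R * 'rV[R]_m * 'rV[R]_d | 0 <= q.1.1 < T /\ D q.2] in
  exists (vt : R -> 'rV[R]_m -> 'rV[R]_d -> R)
         (vx : R -> 'rV[R]_m -> 'rV[R]_d -> 'rV[R]_m)
         (vxx : R -> 'rV[R]_m -> 'rV[R]_d -> 'M[R]_m)
         (vy : R -> 'rV[R]_m -> 'rV[R]_d -> 'rV[R]_d)
         (vyy : R -> 'rV[R]_m -> 'rV[R]_d -> 'M[R]_d),
  [/\ [/\ {within Q, continuous (fun q => v q.1.1 q.1.2 q.2)},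
          {within Q, continuous (fun q => vt q.1.1 q.1.2 q.2)},
          {within Q, continuous (fun q => vx q.1.1 q.1.2 q.2)},
          {within Q, continuous (fun q => vxx q.1.1 q.1.2 q.2)}
        & {within Q, continuous (fun q => vy q.1.1 q.1.2 q.2)} /\
          {within Q, continuous (fun q => vyy q.1.1 q.1.2 q.2)}],
      (forall (t : R) x y, 0 < t < T -> interior D y ->
        [/\ is_derive t (1 : R) (fun r : R => v r x y) (vt t x y),
            forall i, partial (fun z => v t z y) x i (vx t x y 0 i),
            forall i j, partial (fun z => vx t z y 0 i) x j (vxx t x y i j),
            forall i, partial (fun z => v t x z) y i (vy t x y 0 i)
          & forall i j, partial (fun z => vy t x z 0 i) y j (vyy t x y i j)])
    & forall (t : R) x y, 0 <= t < T -> D y ->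
        (jump_leb M).-integrable setT (fun z =>
           ((v t (x + z *m (gamma_X M y)^T) y - v t x y)
            * (intensity M * jump_density M z))%:E) /\
        vt t x y + generator M (v t) (vx t x y) (vxx t x y)
                     (vy t x y) (vyy t x y) x y = 0].

(** ** Standing assumptions *)

Record standing_assumptions M D (T : R) (f : 'rV[R]_m -> 'rV[R]_d -> R)
    (S : R -> 'rV[R]_m -> 'rV[R]_d -> setup) : Prop := StandingAssumptions {
  sa_domain : convex_domain_or_closure D;
  sa_jumps : jump_law_ok M;
  sa_measurable :
    [/\ measurable_fun D (mu_X M), measurable_fun D (sigma_X M),
        measurable_fun D (gamma_X M), measurable_fun D (mu_Y M)
      & measurable_fun D (sigma_Y M)];
  sa_solution : forall (t : R) x y, 0 <= t <= T -> D y -> weak_solution M D t T x y (S t x y);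
  sa_unique : forall (t : R) x y S1 S2, 0 <= t <= T -> D y ->
    weak_solution M D t T x y S1 -> weak_solution M D t T x y S2 ->
    same_law t T S1 S2;
  sa_growth :
    [/\ poly_growth D (mu_X M), poly_growth D (mu_Y M) & poly_growth D (sigma_X M)];
  sa_gamma : (forall y, D y -> gamma_X M y = 0) \/
    0 < inf [set enorm (gamma_X M y) | y in D];
  sa_payoff : measurable_fun (setT `*` D) (fun q => f q.1 q.2);
  sa_payoff_int : forall (t : R) x y, 0 <= t <= T -> D y -> expectable S t T f x y;
  sa_pide : solves_backward_pide M D T (fun t => expect S t T f);
  sa_terminal : forall x y, D y -> expect S T T f x y = f x y }.

End jump_diffusion.

(** * Grids and operators on l_p *)

Section grid.
Context {R : realType} {m : nat}.
Implicit Types (p : \bar R) (dx : 'rV[R]_m).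

(* A function on the grid is encoded as a function of the multi-index [i]. *)
Definition gridfun := 'rV[int]_m -> R.

Definition grid (X0 : 'rV[R]_m) dx (i : 'rV[int]_m) : 'rV[R]_m :=
  \row_k (X0 0 k + (i 0 k)%:~R * dx 0 k).

Definition lp_norm p dx (phi : gridfun) : \bar R :=
  match p with
  | r%:E => ((\esum_(i in [set: 'rV[int]_m])
                (`|phi i| `^ r * \prod_k dx 0 k)%:E) `^ r^-1)%E
  | +oo%E => ereal_sup [set (`|phi i|)%:E | i in [set: 'rV[int]_m]]
  | -oo%E => 0%E
  end.

Definition in_lp p dx (phi : gridfun) : Prop := (lp_norm p dx phi < +oo)%E.

Definition lp_operator p dx (G : gridfun -> gridfun) : Prop :=
  (forall phi, in_lp p dx phi -> in_lp p dx (G phi)) /\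
  (forall (a : R) phi psi, in_lp p dx phi -> in_lp p dx psi ->
     G (fun i => a * phi i + psi i) = (fun i => a * G phi i + G psi i)).

Definition op_norm p dx (G : gridfun -> gridfun) : \bar R :=
  ereal_sup [set lp_norm p dx (G phi) | phi in [set phi | lp_norm p dx phi <= 1%:E]%E].

End grid.
Arguments gridfun : clear implicits.

(** * Approximating Markov chain *)

Definition markov_chain {R : realType} {d : nat} {dO : measure_display}
    {Om : measurableType dO} (P : probability Om R) (D : set 'rV[R]_d)
    (Y0 : 'rV[R]_d) (N : nat) (St : nat -> set 'rV[R]_d)
    (kap : nat -> R.-pker 'rV[R]_d ~> 'rV[R]_d)
    (Yh : nat -> Om -> 'rV[R]_d) : Prop :=
  [/\ forall n, (n <= N)%N ->
        [/\ measurable (St n), St n `<=` D, measurable_fun setT (Yh n)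
          & forall w, St n (Yh n w)],
      forall w, Yh 0 w = Y0,
      forall n y, (n < N)%N -> St n y -> kap n y (St n.+1) = 1%:E
    & forall n, (n < N)%N -> forall A,
        sigma_proc [set k | (k <= n)%N] Yh A ->
        forall U : set 'rV[R]_d, measurable U ->
        P (A `&` Yh n.+1 @^-1` U) = (\int[P]_(w in A) kap n (Yh n w) U)%E].

(** * Backward recursions *)

(* [backward step N n v] is the value at time n of the recursion
   w_N = v, w_k = step k w_(k+1). *)
Definition backward {A : Type} (step : nat -> A -> A) (N n : nat) (v : A) : A :=
  (fix rec (k : nat) : A :=
     if k is k'.+1 then step (N - k)%N (rec k') else v) (N - n)%N.

Section schemes.
Context {R : realType} {m d lB lW lH : nat}.
Variables (S : R -> 'rV[R]_m -> 'rV[R]_d -> setup R m d lB lW lH).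
Variables (T : R) (f g : 'rV[R]_m -> 'rV[R]_d -> R).

Definition utilde (N n : nat) : 'rV[R]_m -> 'rV[R]_d -> R :=
  let h := T / N%:R in
  backward (fun k v x y => Num.max (g x y) (expect S (k%:R * h) (k.+1%:R * h) v x y))
    N n f.

Definition utilde_well_defined (D : set 'rV[R]_d) (N : nat) : Prop :=
  let h := T / N%:R in
  forall n x y, (n < N)%N -> D y ->
    expectable S (n%:R * h) (n.+1%:R * h) (utilde N n.+1) x y.

(* E[Pi(y) w(., Y_(n+1)) | Y_n = y], through the transition kernel of Y. *)
Definition scheme_expect (Pi : 'rV[R]_d -> gridfun R m -> gridfun R m)
    (St : nat -> set 'rV[R]_d) (kap : nat -> R.-pker 'rV[R]_d ~> 'rV[R]_d)
    (n : nat) (w : 'rV[int]_m -> 'rV[R]_d -> R) (i : 'rV[int]_m) (y : 'rV[R]_d) : R :=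
  \int[kap n y]_(z in St n.+1) Pi y (w ^~ z) i.

(* w_n(., Y_n) is an l_p-valued random variable for n = 1, ..., N and the
   conditional expectations in [scheme_expect] exist. *)
Definition scheme_well_defined (p : \bar R) (dx : 'rV[R]_m)
    (Pi : 'rV[R]_d -> gridfun R m -> gridfun R m)
    (St : nat -> set 'rV[R]_d) (kap : nat -> R.-pker 'rV[R]_d ~> 'rV[R]_d)
    (N : nat) (w : nat -> 'rV[int]_m -> 'rV[R]_d -> R) : Prop :=
  (forall n, (0 < n <= N)%N ->
     (forall y, St n y -> in_lp p dx (w n ^~ y)) /\
     (forall i, measurable_fun (St n) (w n i))) /\
  (forall n y i, (n < N)%N -> St n y ->
     (kap n y).-integrable (St n.+1) (fun z => (Pi y (w n.+1 ^~ z) i)%:E)).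

Definition uscheme (X0 dx : 'rV[R]_m)
    (Pi : 'rV[R]_d -> gridfun R m -> gridfun R m)
    (St : nat -> set 'rV[R]_d) (kap : nat -> R.-pker 'rV[R]_d ~> 'rV[R]_d)
    (N n : nat) : 'rV[int]_m -> 'rV[R]_d -> R :=
  backward (fun k w i y =>
      Num.max (g (grid X0 dx i) y) (scheme_expect Pi St kap k w i y))
    N n (fun i y => f (grid X0 dx i) y).

(* The time step is h = T / N. The remainder [Rem] is meaningful only for n < N,
   so the bound on it is stated for those n. *)
Definition assumption_B (D : set 'rV[R]_d) (X0 : 'rV[R]_m)
    {dO : measure_display} {Om : measurableType dO} (P : probability Om R)
    (St : nat -> nat -> set 'rV[R]_d)
    (kap : nat -> nat -> R.-pker 'rV[R]_d ~> 'rV[R]_d)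
    (Yh : nat -> nat -> Om -> 'rV[R]_d)
    (Pi : nat -> 'rV[R]_m -> 'rV[R]_d -> gridfun R m -> gridfun R m)
    (p : \bar R) (c : 'rV[R]_d -> R) (Err : R -> 'rV[R]_m -> R) : Prop :=
  let ut N dx n i y := utilde N n (grid X0 dx i) y in
  [/\ [/\ (1%:E <= p)%E, measurable_fun D c, forall y, D y -> 0 <= c y,
          forall (h : R) (dx : 'rV[R]_m), 0 < h -> (forall k, 0 < dx 0 k) -> 0 <= Err h dx
        & Err q.1 q.2 @[q --> within
            [set q : R * 'rV[R]_m | 0 < q.1 /\ forall k, 0 < q.2 0 k]
            (nbhs ((0, 0) : R * 'rV[R]_m))] --> (0 : R)],
      forall N (dx : 'rV[R]_m) y, (0 < N)%N -> (forall k, 0 < dx 0 k) -> D y ->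
        lp_operator p dx (Pi N dx y) /\
        (op_norm p dx (Pi N dx y) <= (1 + c y * (T / N%:R))%:E)%E,
      forall N (dx : 'rV[R]_m), (0 < N)%N -> (forall k, 0 < dx 0 k) ->
        scheme_well_defined p dx (Pi N dx) (St N) (kap N) N (ut N dx)
    & exists Rem : nat -> 'rV[R]_m -> nat -> 'rV[int]_m -> 'rV[R]_d -> R,
      [/\ forall N (dx : 'rV[R]_m) n i y, (0 < N)%N -> (forall k, 0 < dx 0 k) -> (n < N)%N ->
            St N n y ->
            scheme_expect (Pi N dx) (St N) (kap N) n (ut N dx n.+1) i y =
            expect S (n%:R * (T / N%:R)) (n.+1%:R * (T / N%:R))
              (utilde N n.+1) (grid X0 dx i) y
            + Rem N dx n i y,
          forall N (dx : 'rV[R]_m) n i, (0 < N)%N -> (forall k, 0 < dx 0 k) -> (n < N)%N ->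
            measurable_fun (St N n) (Rem N dx n i)
        & exists hbar C : R, [/\ 0 < hbar < 1, 0 < C
          & forall N (dx : 'rV[R]_m) n, (0 < N)%N -> T / N%:R < hbar ->
              (forall k, 0 < dx 0 k) -> enorm dx < 1 -> (n < N)%N ->
              (Lnorm P (if p == +oo then 1 else p)
                 (fun w => (expR (\sum_(1 <= l < n.+1)
                                    c (Yh N l w) * (T / N%:R)))%:E
                           * lp_norm p dx (fun i => Rem N dx n i (Yh N n w)))
               <= (C * (T / N%:R) * Err (T / N%:R) dx)%:E)%E]]].

End schemes.

(* Main.v *)
Require Import Defs.
From HB Require Import structures.
From mathcomp Require Import all_boot all_order all_algebra.
From mathcomp Require Import finmap.
From mathcomp Require Import all_classical all_reals all_analysis.
From mathcomp Require Import measurable_realfun.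
From mathcomp Require Import ring lra.
Import Order.TTheory GRing.Theory Num.Theory.
Import numFieldNormedType.Exports.
Local Open Scope classical_set_scope.
Local Open Scope ring_scope.

(** The error [e_n = v_n - u_n] between the semi-discrete value [v] and the
    scheme [u] satisfies a linear backward inequality. Taking the maximum with
    the same obstacle [g] is 1-Lipschitz, so for every reachable [y]
      |e_n(i, y)| <= |E[Pi(y) e_{n+1}(., Y_{n+1})(i) | Y_n = y]| + |Rem_n(i, y)|,
    and the operator [Pi(y)] expands l_p norms by at most
    [1 + c(y) h <= exp(c(y) h)].

    The argument follows the [q]-th power of the l_p norm (the [energy], with
    [q = p] for finite [p] and [q = 1] for the sup norm), weighted by
    [exp(q h sum_{l < n} c(Y_l))] and averaged over the chain; call this [E_n].
    For finite [p] this power is a sum over the grid points, which has two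
    benefits. First, Jensen's inequality for the transition kernel at each grid
    point, followed by Tonelli, moves the conditional expectation outside the
    norm ([energy_Rintegral]; for the sup norm, a supremum of integrals is at
    most the integral of the supremum). Second, Minkowski's inequality can be
    replaced by the convexity bound
    [(a + b)^q <= t (a/t)^q + (1-t) (b/(1-t))^q]
    ([powR_split], [energy_split]), which survives summation and integration
    whether or not the quantities are finite. The Markov property
    ([integral_kernel_step]) turns the conditional expectation weighted by the
    past into [E_{n+1}], and one gets, for every [t] in ]0,1[,
      E_n <= t t^{-q} E_{n+1} + (1-t) (1-t)^{-q} delta^q
    with [delta = exp(c(Y_0) h) eps], where [eps = C h Err] bounds the
    remainders. Choosing [t = (k+1)/(k+2)] at distance [k+1] from maturity gives
    [E_0 <= ((N+1) delta)^q] ([split_recursion]), that is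
    [|e_0(., Y_0)|_p <= (N+1) delta] ([grid_error_bound]). Since
    [N + 1 <= 2 N], [N h = T] and [h < 1], the constant [2 exp(c(Y_0)) C] works. *)

(** * Convexity of powers *)

Section scalar.
Context {R : realType}.
Implicit Types (q a b t : R).

(** Convexity at the weights [t], [1 - t], applied to [a / t] and [b / (1 - t)].
    Optimising over [t] recovers Minkowski's inequality, so keeping [t] free
    loses nothing. *)
Lemma powR_split q t a b : 1 <= q -> 0 < t < 1 -> 0 <= a -> 0 <= b ->
  (a + b) `^ q <= t * (t^-1) `^ q * a `^ q + (1 - t) * ((1 - t)^-1) `^ q * b `^ q.
Proof.
move=> q1 /andP[t0 t1] a0 b0.
have s0 : 0 < 1 - t by rewrite subr_gt0.
have ta : 0 <= t^-1 * a by rewrite mulr_ge0// invr_ge0 ltW.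
have sb : 0 <= (1 - t)^-1 * b by rewrite mulr_ge0// invr_ge0 ltW.
have : (t * (t^-1 * a) + (1 - t) * ((1 - t)^-1 * b)) `^ q <=
    t * (t^-1 * a) `^ q + (1 - t) * ((1 - t)^-1 * b) `^ q.
  apply: (@convex_powR R q q1 (Itv01 (ltW t0) (ltW t1)));
  by rewrite inE/= in_itv/= andbT.
rewrite mulrA divff ?gt_eqF// mulrA divff ?gt_eqF// !mul1r => /le_trans; apply.
by rewrite !powRM ?invr_ge0 ?(ltW t0) ?(ltW s0)// !mulrA.
Qed.

End scalar.

(** * Functionals that behave like integrals *)

Section integral_like.
Local Open Scope ereal_scope.
Context {d} {T : measurableType d} {R : realType}.
Import HBNNSimple.

(** The properties from which the standard simple-function argument extends an
    identity between indicators to all nonnegative measurable functions. *)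
Definition integral_like (Phi : (T -> \bar R) -> \bar R) : Prop :=
  [/\ forall f, (forall x, 0 <= f x) -> measurable_fun setT f -> 0 <= Phi f,
      forall f g : T -> \bar R, (forall x, 0 <= f x) ->
        measurable_fun setT f -> measurable_fun setT g ->
        (forall x, f x <= g x) -> Phi f <= Phi g,
      forall f g : T -> \bar R, (forall x, 0 <= f x) -> (forall x, 0 <= g x) ->
        measurable_fun setT f -> measurable_fun setT g ->
        Phi (fun x => f x + g x) = Phi f + Phi g,
      forall (r : R) (f : T -> \bar R), (0 <= r)%R -> (forall x, 0 <= f x) ->
        measurable_fun setT f -> Phi (fun x => r%:E * f x) = r%:E * Phi f
    & forall f_ : nat -> T -> \bar R, (forall n x, 0 <= f_ n x) ->
        (forall n, measurable_fun setT (f_ n)) ->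
        (forall x, nondecreasing_seq (f_ ^~ x)) ->
        Phi (fun x => limn (f_ ^~ x)) = limn (fun n => Phi (f_ n))].

(** An integral-like functional commutes with finite combinations of indicators
    and with monotone limits, and simple functions increase to any nonnegative
    measurable function. *)
Lemma eq_integral_like (Phi Psi : (T -> \bar R) -> \bar R) :
  integral_like Phi -> integral_like Psi ->
  (forall A, measurable A ->
    Phi (fun x => (\1_A x)%:E) = Psi (fun x => (\1_A x)%:E)) ->
  forall f, (forall x, 0 <= f x) -> measurable_fun setT f -> Phi f = Psi f.
Proof.
move=> [_ _ PhiD PhiZ Phil] [_ _ PsiD PsiZ Psil] ind f f0 mf.
pose h (s : seq R) (g : {nnsfun T >-> R}) x :=
  \sum_(r <- s) r%:E * (\1_(g @^-1` [set r]) x)%:E.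
have m1 (g : {nnsfun T >-> R}) r : measurable (g @^-1` [set r]).
  exact: measurable_sfunP.
have mi (g : {nnsfun T >-> R}) r :
    measurable_fun setT (fun x => (\1_(g @^-1` [set r]) x)%:E : \bar R).
  by apply/measurable_EFinP; exact: measurable_indic.
(* [h s g] is the part of the simple function [g] taking values in [s]. *)
have sf (g : {nnsfun T >-> R}) (s : seq R) : (forall r, r \in s -> (0 <= r)%R) ->
    [/\ forall x, 0 <= h s g x, measurable_fun setT (h s g)
      & Phi (h s g) = Psi (h s g)].
  elim: s => [_|r s IH s0].
    have -> : h [::] g = fun x => 0%:E * 0 by apply/funext => x; rewrite /h big_nil mul0e.
    split; [by move=> x; rewrite mul0e|exact: measurable_cst|].
    rewrite (PhiZ 0%R (cst 0))// ?(PsiZ 0%R (cst 0))// ?mul0e//;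
    exact: measurable_cst.
  have [h0 mh e] := IH (fun r' r's => s0 r' (mem_behead (s:=r::s) r's)).
  have r0 : (0 <= r)%R by apply: s0; rewrite mem_head.
  have -> : h (r :: s) g = fun x => r%:E * (\1_(g @^-1` [set r]) x)%:E + h s g x.
    by apply/funext => x; rewrite /h big_cons.
  have mr : measurable_fun setT (fun x => r%:E * (\1_(g @^-1` [set r]) x)%:E).
    exact: measurable_funeM.
  have p0 x : 0 <= r%:E * (\1_(g @^-1` [set r]) x)%:E.
    by rewrite mule_ge0// lee_fin.
  split; [by move=> x; rewrite adde_ge0|exact: emeasurable_funD|].
  rewrite PhiD// PsiD// PhiZ// ?PsiZ// ?e ?ind//.
have snn (g : {nnsfun T >-> R}) : Phi (fun x => (g x)%:E) = Psi (fun x => (g x)%:E).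
  have -> : (fun x => (g x)%:E) = h (finmap.enum_fset (fset_set (range g))) g.
    apply/funext => x; rewrite /h /= fimfunE -fsumEFin//.
    rewrite fsbig_finite//; exact: fimfunP.
  have [] // := sf g (finmap.enum_fset (fset_set (range g))).
  move=> r rg; have : r \in fset_set (range g) by [].
  rewrite in_fset_set; last exact: fimfunP.
  by rewrite inE => -[x _ <-].
pose f_ := nnsfun_approx measurableT mf.
have -> : f = fun x => limn (fun n => (f_ n x)%:E).
  by apply/funext => x; apply/esym/cvg_lim => //; exact: cvg_nnsfun_approx.
have mfn n : measurable_fun setT (fun x => (f_ n x)%:E).
  by apply/measurable_EFinP.
have ndf x : nondecreasing_seq (fun n => (f_ n x)%:E).
  by move=> a b ab; rewrite lee_fin; exact/lefP/nd_nnsfun_approx.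
rewrite (Phil (fun n x => (f_ n x)%:E))//; last by move=> n x; rewrite lee_fin.
rewrite (Psil (fun n x => (f_ n x)%:E))//; last by move=> n x; rewrite lee_fin.
by congr (limn _); apply/funext => n; exact: snn.
Qed.
End integral_like.

(** * Sums and suprema over a countable set *)

Section countable_esum.
Local Open Scope ereal_scope.
Context {R : realType} {I : countType}.

(** The enumeration does not depend on the summand, so that families of sums can
    be turned into series simultaneously. *)
Lemma esum_countable (i0 : I) : exists (e : nat -> I) (Q : pred nat),
  forall a : I -> \bar R, (forall i, 0 <= a i) ->
  \esum_(i in [set: I]) a i = \sum_(n <oo | Q n) a (e n).
Proof.
exists (fun n => odflt i0 (pickle_inv n)), (fun n => isSome (@pickle_inv I n)).
move=> a a0; rewrite -esum_pred_image//.
  congr esum; apply/seteqP; split=> // i _ /=; exists (choice.pickle i);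
  by rewrite ?pickleK_inv.
move=> n1 n2; rewrite !inE /=.
have := @pickle_invK I n1; have := @pickle_invK I n2.
case: (pickle_inv n1) => //= x; case: (pickle_inv n2) => //= y.
by move=> <- <- _ _ ->.
Qed.

Lemma esumZl (i0 : I) (r : R) (a : I -> \bar R) : (0 <= r)%R ->
  (forall i, 0 <= a i) ->
  \esum_(i in [set: I]) (r%:E * a i) = r%:E * \esum_(i in [set: I]) a i.
Proof.
move=> r0 a0; have [e [Q eQ]] := esum_countable i0.
rewrite !eQ//; last by move=> i; rewrite mule_ge0.
by rewrite nneseriesZl// => n _; exact: a0.
Qed.

Context {d} {T : measurableType d} (D : set T) (f : I -> T -> \bar R).
Hypotheses (mD : measurable D) (f0 : forall i x, 0 <= f i x)
  (mf : forall i, measurable_fun D (f i)).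

Lemma measurable_esum (i0 : I) :
  measurable_fun D (fun x => \esum_(i in [set: I]) f i x).
Proof.
have [e [Q eQ]] := esum_countable i0.
under eq_fun do rewrite eQ//.
by apply: ge0_emeasurable_sum.
Qed.

Lemma integral_esum (i0 : I) (mu : {measure set T -> \bar R}) :
  \int[mu]_(x in D) (\esum_(i in [set: I]) f i x) =
  \esum_(i in [set: I]) (\int[mu]_(x in D) f i x).
Proof.
have [e [Q eQ]] := esum_countable i0.
under eq_integral do rewrite eQ//.
rewrite eQ; last by move=> i; apply: integral_ge0.
under eq_integral do rewrite eseries_mkcond.
rewrite integral_nneseries//.
- rewrite [RHS]eseries_mkcond; apply: eq_eseriesr => n _.
  by case: (Q n); rewrite ?integral0.
- by move=> n; case: (Q n) => //; exact: measurable_cst.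
- by move=> n x _; case: (Q n).
Qed.

Lemma measurable_sup_countable (i0 : I) :
  measurable_fun D (fun x => ereal_sup [set f i x | i in [set: I]]).
Proof.
pose u n := odflt i0 (choice.unpickle n).
have := @measurable_fun_esups _ _ _ D (fun n => f (u n)) (fun n => mf (u n)) 0%N.
congr measurable_fun; apply/funext => x; congr ereal_sup.
apply/seteqP; split=> _ [n _ <-]; first by exists (u n).
by exists (choice.pickle n) => //=; rewrite /u choice.pickleK.
Qed.
End countable_esum.

(** * Jensen's inequality for powers *)

Section jensen.
Local Open Scope ereal_scope.
Context {d} {T : measurableType d} {R : realType}.

(** Hoelder's inequality against the constant 1 on a probability space; the
    restriction to [D] is absorbed by extending [f] by 0. *)
Lemma jensen_powR (mu : {measure set T -> \bar R}) (D : set T) (f : T -> R) (q : R) :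
  mu setT = 1 -> measurable D -> (1 <= q)%R ->
  mu.-integrable D (EFin \o f) ->
  (`|\int[mu]_(x in D) f x|%R `^ q)%:E <= \int[mu]_(x in D) (`|f x| `^ q)%:E.
Proof.
move=> mu1 mD q1 intf.
have q0 : (0 < q)%R by rewrite (lt_le_trans _ q1).
have mf : measurable_fun D f by apply/measurable_EFinP; exact: measurable_int intf.
pose F := f \_ D.
have mF : measurable_fun setT F by exact/(measurable_restrictT _ mD).1.
have FE : \int[mu]_(x in D) (`|f x| `^ q)%:E = \int[mu]_x (`|F x| `^ q)%:E.
  rewrite integral_mkcond; apply: eq_integral => x _.
  by rewrite /F /patch; case: (x \in D); rewrite // normr0 powR0// gt_eqF.
have F1 : (`|\int[mu]_(x in D) f x|%R)%:E <= \int[mu]_x `|F x|%:E.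
  apply: (@le_trans _ _ (\int[mu]_(x in D) `|f x|%:E)).
    have mfE : measurable_fun D (EFin \o f) by apply/measurable_EFinP.
    have := le_abse_integral mu mD mfE.
    have := integrable_fin_num mD intf; rewrite /Rintegral /=.
    by case: (\int[mu]_(x in D) (f x)%:E).
  rewrite integral_mkcond le_eqVlt; apply/orP; left; apply/eqP.
  apply: eq_integral => x _.
  by rewrite /F /patch; case: (x \in D); rewrite // normr0.
have F2 : \int[mu]_x `|F x|%:E <= (\int[mu]_x (`|F x| `^ q)%:E) `^ q^-1.
  move: q1; rewrite le_eqVlt => /orP[/eqP <-|q1].
    rewrite invr1 poweRe1; last by apply: integral_ge0.
    by under [leRHS]eq_integral do rewrite powRr1//.
  have q1' : (0 < 1 - q^-1)%R by rewrite subr_gt0 invf_lt1.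
  have := @hoelder _ _ _ mu F (cst 1%R) q (1 - q^-1)^-1 mF (measurable_cst _ ) q0 _ _.
  rewrite invr_gt0 q1' invrK subrKC => /(_ isT erefl).
  have -> : 'N[mu]_1 [EFin \o (F \* cst 1)%R] = \int[mu]_x `|F x|%:E.
    by rewrite Lnorm1; apply: eq_integral => x _ /=; rewrite mulr1.
  have -> : 'N[mu]_(((1 - q^-1)^-1)%R%:E)[EFin \o cst 1%R] = 1.
    by rewrite (Lnorm_cst1 mu) invrK mu1 poweR1r.
  by rewrite mule1 unlock.
rewrite FE -poweR_EFin.
have I0 : 0 <= \int[mu]_x (`|F x| `^ q)%:E by apply: integral_ge0.
rewrite [leRHS](_ : _ = ((\int[mu]_x (`|F x| `^ q)%:E) `^ q^-1) `^ q).
  apply: gt0_ler_poweR; rewrite ?(ltW q0)// ?in_itv/= ?leey ?andbT ?poweR_ge0//.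
  exact: le_trans F2.
by rewrite -poweRrM mulVf ?gt_eqF// poweRe1.
Qed.
End jensen.

(** * Powers of l_p norms on the grid *)

Section energy.
Local Open Scope ereal_scope.
Context {R : realType} {m : nat}.
Variables (p : \bar R) (dx : 'rV[R]_m).
Hypotheses (p1 : 1 <= p) (dx0 : forall k, (0 < dx 0%R k)%R).
Implicit Types phi psi : gridfun R m.

Definition energy_exponent : R := if p is r%:E then r else 1%R.

(** The [energy_exponent]-th power of the l_p norm. For [p = +oo] the exponent is
    1, in accordance with the L^1 bound on the remainder in that case. *)
Definition energy phi : \bar R :=
  match p with
  | r%:E => \esum_(i in [set: 'rV[int]_m]) (`|phi i| `^ r * \prod_k dx 0%R k)%:E
  | +oo => ereal_sup [set (`|phi i|)%:E | i in [set: 'rV[int]_m]]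
  | -oo => 0
  end.
Local Notation q := energy_exponent.

Lemma energy_exponent_ge1 : (1 <= q)%R.
Proof. by move: p1; rewrite /q; case: p. Qed.

Lemma energy_exponent_gt0 : (0 < q)%R.
Proof. exact: lt_le_trans energy_exponent_ge1. Qed.

Lemma cell_volume_ge0 : (0 <= \prod_k dx 0 k)%R.
Proof. by apply: prodr_ge0 => k _; exact: ltW. Qed.

Lemma energy_ge0 phi : 0 <= energy phi.
Proof.
rewrite /energy; case: p => // [r|].
  by apply: esum_ge0 => i _; rewrite lee_fin mulr_ge0 ?powR_ge0 ?cell_volume_ge0.
by apply: le_trans (ereal_sup_ubound _) => /=; last by exists 0%R.
Qed.

Lemma lp_normE phi : lp_norm p dx phi = energy phi `^ q^-1.
Proof.
have := energy_ge0 phi.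
by rewrite /lp_norm /energy /q; case: p p1 => // _ ?; rewrite invr1 poweRe1.
Qed.

Lemma energyE phi : energy phi = lp_norm p dx phi `^ q.
Proof.
by rewrite lp_normE -poweRrM mulVf ?gt_eqF ?energy_exponent_gt0// poweRe1// energy_ge0.
Qed.

Lemma lp_norm_ge0 phi : 0 <= lp_norm p dx phi.
Proof. by rewrite lp_normE poweR_ge0. Qed.

Lemma energyZ (a : R) phi : (0 <= a)%R ->
  energy (fun i => a * phi i)%R = (a `^ q)%:E * energy phi.
Proof.
move=> a0; rewrite /energy /q; case: p p1 => // [r _|_].
  rewrite -(esumZl 0%R) ?powR_ge0//; last first.
    by move=> i; rewrite lee_fin mulr_ge0 ?powR_ge0 ?cell_volume_ge0.
  apply: eq_esum => i _.
  by rewrite -EFinM normrM powRM// (ger0_norm a0) mulrA.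
rewrite powRr1// -ereal_supZl//; last by apply/set0P; exists `|phi 0%R|%:E, 0%R.
congr ereal_sup; apply/seteqP; split=> [_ [i _ <-]|_ [_ [i _ <-] <-]].
  by exists `|phi i|%:E; [exists i|rewrite normrM (ger0_norm a0)].
by exists i; rewrite // normrM (ger0_norm a0).
Qed.

Lemma lp_normZ (a : R) phi : (0 <= a)%R ->
  lp_norm p dx (fun i => a * phi i)%R = a%:E * lp_norm p dx phi.
Proof.
move=> a0; rewrite !lp_normE energyZ// poweRM ?lee_fin ?powR_ge0 ?energy_ge0//.
by rewrite poweR_EFin -powRrM mulfV ?gt_eqF ?energy_exponent_gt0// powRr1.
Qed.

(** This plays the role of the triangle inequality: [powR_split] is summed over
    the grid points, and for [p = +oo] both coefficients are 1. *)
Lemma energy_split (t : R) phi psi chi : (0 < t < 1)%R ->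
  (forall i, `|phi i| <= `|psi i| + `|chi i|)%R ->
  energy phi <= (t * t^-1 `^ q)%:E * energy psi
    + ((1 - t) * (1 - t)^-1 `^ q)%:E * energy chi.
Proof.
move=> t01 h; have /andP[t0 t1] := t01.
have s0 : (0 < 1 - t)%R by rewrite subr_gt0.
have := energy_exponent_ge1; rewrite /energy /q; case: p p1 => // [r _ r1|_ _].
  have v0 := cell_volume_ge0.
  have tt0 : (0 <= t * t^-1 `^ r)%R by rewrite mulr_ge0 ?powR_ge0// ltW.
  have ss0 : (0 <= (1 - t) * (1 - t)^-1 `^ r)%R by rewrite mulr_ge0 ?powR_ge0// ltW.
  have w0 (f : gridfun R m) i : 0 <= (`|f i| `^ r * \prod_k dx 0%R k)%:E.
    by rewrite lee_fin mulr_ge0 ?powR_ge0.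
  rewrite -!(esumZl 0%R)// -esumD; last 2 first.
    by move=> i _; rewrite mule_ge0.
    by move=> i _; rewrite mule_ge0.
  apply: le_esum => i _; rewrite -!EFinM -EFinD lee_fin !mulrA -mulrDl.
  apply: ler_wpM2r => //.
  apply: (@le_trans _ _ ((`|psi i| + `|chi i|) `^ r)%R); last exact: powR_split.
  apply: ge0_ler_powR; rewrite ?nnegrE ?addr_ge0//.
  exact: le_trans r1.
rewrite !powRr1 ?invr_ge0 ?(ltW t0) ?(ltW s0)// !mulfV ?gt_eqF// !mul1e.
apply: ge_ereal_sup => _ [i _ <-].
apply: (@le_trans _ _ (`|psi i|%:E + `|chi i|%:E)); first by rewrite lee_fin.
by apply: leeD; apply: ereal_sup_ubound; exists i.
Qed.

Lemma in_lpB phi psi : in_lp p dx phi -> in_lp p dx psi ->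
  in_lp p dx (fun i => phi i - psi i)%R.
Proof.
rewrite /in_lp => lphi lpsi; rewrite lp_normE; apply: poweR_lty.
have half : (0 < (2^-1 : R) < 1)%R by apply/andP; lra.
have := @energy_split _ (fun i => phi i - psi i)%R phi psi half (fun i => ler_normB _ _).
move=> /le_lt_trans; apply.
rewrite !energyE; apply: lte_add_pinfty; apply: lte_mul_pinfty => //;
by [rewrite lee_fin mulr_ge0 ?powR_ge0//; lra|exact: poweR_lty].
Qed.

(** The operator norm only controls the unit ball. Rescaling [phi] by any
    [t > 0] above its norm, rather than by the norm itself, also covers the
    functions of norm 0. *)
Lemma operator_bound (G : gridfun R m -> gridfun R m) (M : R) phi :
  (0 <= M)%R -> lp_operator p dx G -> op_norm p dx G <= M%:E ->
  in_lp p dx phi -> energy (G phi) <= (M `^ q)%:E * energy phi.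
Proof.
move=> M0 [Glp Glin] GM plp.
suff H : lp_norm p dx (G phi) <= M%:E * lp_norm p dx phi.
  rewrite !energyE -poweR_EFin -poweRM ?lee_fin ?lp_norm_ge0//.
  apply: gt0_ler_poweR => //; rewrite ?in_itv/= ?leey ?andbT ?lp_norm_ge0//.
  - exact: ltW energy_exponent_gt0.
  - by rewrite mule_ge0 ?lp_norm_ge0.
pose z : gridfun R m := fun=> 0%R.
have zlp : in_lp p dx z.
  rewrite /in_lp (_ : z = fun i => 0 * phi i)%R ?lp_normZ ?mul0e//.
  by apply/funext => i; rewrite mul0r.
have Gz : G z = z.
  have := Glin 1%R z z zlp zlp.
  rewrite (_ : (fun _ => _) = z); last by apply/funext => i; rewrite /z mul1r addr0.
  move=> e; apply/funext => i; have := congr1 (fun f => f i) e => /=.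
  by rewrite mul1r => /eqP; rewrite -subr_eq subrr eq_sym => /eqP.
have GZ a : G (fun i => a * phi i)%R = (fun i => a * G phi i)%R.
  have := Glin a phi z plp zlp; rewrite Gz.
  rewrite (_ : (fun i => a * phi i + z i)%R = (fun i => a * phi i)%R); last first.
    by apply/funext => i; rewrite addr0.
  by move=> ->; apply/funext => i; rewrite addr0.
have main (t : R) : (0 < t)%R -> lp_norm p dx phi <= t%:E ->
    lp_norm p dx (G phi) <= M%:E * t%:E.
  move=> t0 ht.
  have : lp_norm p dx (G (fun i => t^-1 * phi i)%R) <= M%:E.
    apply: le_trans GM; apply: ereal_sup_ubound; exists (fun i => t^-1 * phi i)%R => //=.
    by rewrite lp_normZ ?invr_ge0 ?(ltW t0)// lee_pdivrMl// mule1.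
  by rewrite GZ lp_normZ ?invr_ge0 ?(ltW t0)// lee_pdivrMl// muleC.
have nfin : lp_norm p dx phi \is a fin_num by rewrite ge0_fin_numE ?lp_norm_ge0.
apply/lee_addgt0Pr => e e0.
pose s := (e / (M + 1))%R.
have s0 : (0 < s)%R by rewrite divr_gt0// ltr_wpDl.
have n0 : (0 <= fine (lp_norm p dx phi))%R by rewrite fine_ge0// lp_norm_ge0.
have := main (fine (lp_norm p dx phi) + s)%R (ltr_wpDl n0 s0) _.
rewrite EFinD fineK// leeDl ?lee_fin ?(ltW s0)// => /(_ isT) /le_trans; apply.
rewrite -{1}(fineK nfin) muleDr// fineK// leeD2l// -EFinM lee_fin /s.
by rewrite mulrA ler_pdivrMr ?ltr_wpDl// mulrC ler_wpM2l ?(ltW e0)// lerDl.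
Qed.

Section family.
Context {d} {T : measurableType d} (D : set T) (phi : 'rV[int]_m -> T -> R).
Hypothesis mD : measurable D.

Lemma measurable_energy : (forall i, measurable_fun D (phi i)) ->
  measurable_fun D (fun z => energy (phi ^~ z)).
Proof.
move=> mphi; rewrite /energy; case: p => [r||]; last exact: measurable_cst.
  apply: (measurable_esum D
    (fun i z => (`|phi i z| `^ r * \prod_k dx 0%R k)%:E) _ _ 0%R) => //.
    by move=> i x; rewrite lee_fin mulr_ge0 ?powR_ge0 ?cell_volume_ge0.
  move=> i; apply/measurable_EFinP; apply: measurable_funM => //.
  apply: (measurableT_comp (measurable_powR r)).
  exact: measurableT_comp.
apply: (measurable_sup_countable D (fun i z => `|phi i z|%:E) _ 0%R) => i.
apply/measurable_EFinP; exact: measurableT_comp.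
Qed.

(** Averaging over a probability does not increase the energy: Jensen at every
    grid point, then Tonelli. *)
Lemma energy_Rintegral (mu : {measure set T -> \bar R}) : mu setT = 1 ->
  (forall i, mu.-integrable D (EFin \o phi i)) ->
  energy (fun i => (\int[mu]_(z in D) phi i z)%R) <=
  \int[mu]_(z in D) energy (phi ^~ z).
Proof.
move=> mu1 intphi.
have mphi i : measurable_fun D (phi i).
  by apply/measurable_EFinP; exact: measurable_int (intphi i).
have mE := measurable_energy mphi.
have v0 := cell_volume_ge0.
move: mE; have := energy_exponent_ge1; rewrite /energy /q.
case: p p1 => // [r _ r1 _|_ _ mE].
  have mpow i : measurable_fun D (fun z => (`|phi i z| `^ r)%R).
    by apply: (measurableT_comp (measurable_powR r)); exact: measurableT_comp.
  rewrite (integral_esum D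
    (fun i z => (`|phi i z| `^ r * \prod_k dx 0%R k)%:E) mD _ _ 0%R)//; last 2 first.
    by move=> i x; rewrite lee_fin mulr_ge0 ?powR_ge0.
    by move=> i; apply/measurable_EFinP; apply: measurable_funM.
  apply: le_esum => i _; rewrite EFinM.
  under eq_integral do rewrite EFinM muleC.
  rewrite ge0_integralZl//; last first.
    exact/measurable_EFinP.
  rewrite muleC; apply: lee_wpmul2l => //; exact: jensen_powR.
apply: ge_ereal_sup => _ [i _ <-].
have := @jensen_powR _ _ _ mu D (phi i) 1%R mu1 mD (lexx _) (intphi i).
rewrite powRr1// => /le_trans; apply.
apply: ge0_le_integral => //.
- apply/measurable_EFinP; apply: (measurableT_comp (measurable_powR 1%R)).
  exact: measurableT_comp.
- by move=> z _; rewrite powRr1//; apply: ereal_sup_ubound; exists i.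
Qed.
End family.
End energy.

(** * Conditioning on the past through a kernel *)

Section integral_like_instances.
Local Open Scope ereal_scope.
Context {d} {T : measurableType d} {R : realType}.

Lemma integral_like_eval (x : T) : integral_like (fun f : T -> \bar R => f x).
Proof. by split=> //. Qed.

Lemma integral_like_integral (mu : {measure set T -> \bar R}) :
  integral_like (fun f => \int[mu]_x f x).
Proof.
split.
- by move=> f f0 _; exact: integral_ge0.
- by move=> f g f0 mf mg fg; exact: ge0_le_integral.
- by move=> f g f0 g0 mf mg; rewrite ge0_integralD.
- by move=> r f r0 f0 mf; rewrite ge0_integralZl.
- by move=> f_ f0 mf nd; rewrite monotone_convergence.
Qed.

(** With [L w] an evaluation or a kernel average, this covers both sides of
    [integral_kernel_step]. *)
Lemma integral_like_mixture {d'} {T' : measurableType d'}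
    (mu : {measure set T' -> \bar R}) (k : T' -> R)
    (L : T' -> (T -> \bar R) -> \bar R) :
  (forall w, 0 <= k w)%R -> measurable_fun setT k ->
  (forall w, integral_like (L w)) ->
  (forall f, (forall x, 0 <= f x) -> measurable_fun setT f ->
    measurable_fun setT (L ^~ f)) ->
  integral_like (fun f => \int[mu]_w ((k w)%:E * L w f)).
Proof.
move=> k0 mk LL mL.
have mkL f : (forall x, 0 <= f x) -> measurable_fun setT f ->
    measurable_fun setT (fun w => (k w)%:E * L w f).
  by move=> f0 mf; apply: emeasurable_funM; [exact/measurable_EFinP|exact: mL].
have kL0 f w : (forall x, 0 <= f x) -> measurable_fun setT f ->
    0 <= (k w)%:E * L w f.
  by move=> f0 mf; case: (LL w) => L0 _ _ _ _; rewrite mule_ge0 ?lee_fin ?L0.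
split.
- by move=> f f0 mf; apply: integral_ge0 => w _; exact: kL0.
- move=> f g f0 mf mg fg; have g0 x : 0 <= g x by rewrite (le_trans (f0 x)).
  apply: ge0_le_integral => //; [|exact: mkL|exact: mkL|] => w _.
    exact: kL0.
  by case: (LL w) => _ Lle _ _ _; rewrite lee_wpmul2l ?lee_fin ?Lle.
- move=> f g f0 g0 mf mg.
  rewrite -(ge0_integralD mu measurableT (fun w _ => kL0 f w f0 mf)
    (mkL f f0 mf) (fun w _ => kL0 g w g0 mg) (mkL g g0 mg)).
  apply: eq_integral => w _; case: (LL w) => L0 _ LD _ _.
  by rewrite LD// ge0_muleDr// L0.
- move=> r f r0 f0 mf.
  rewrite -(ge0_integralZl mu measurableT (mkL f f0 mf) (fun w _ => kL0 f w f0 mf))//.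
  by apply: eq_integral => w _; case: (LL w) => _ _ _ LZ _; rewrite LZ// muleCA.
- move=> f_ f0 mf nd.
  have ndL w : nondecreasing_seq (fun n => L w (f_ n)).
    move=> a b ab; case: (LL w) => _ Lle _ _ _; apply: Lle => // x; exact: nd.
  rewrite -monotone_convergence//; last 3 first.
    by move=> n; exact: mkL.
    by move=> n w _; exact: kL0.
    by move=> w _ a b ab; rewrite lee_wpmul2l ?lee_fin ?ndL.
  apply: eq_integral => w _; case: (LL w) => _ _ _ _ Ll; rewrite Ll//.
  apply/esym/cvg_lim => //; apply: cvgeZl => //.
  exact: ereal_nondecreasing_is_cvgn.
Qed.
End integral_like_instances.

Section conditional_kernel.
Local Open Scope ereal_scope.
Context {R : realType} {d d' : measure_display} {Om : measurableType d}
  {T : measurableType d'}.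
Variables (P : probability Om R) (G : set (set Om)) (Y Y' : Om -> T)
  (kap : R.-pker T ~> T).
Hypotheses (GO : <<s G>> `<=` @measurable d Om)
  (mY : measurable_fun setT Y) (mY' : measurable_fun setT Y').
Hypothesis kapP : forall A, <<s G>> A -> forall U, measurable U ->
  P (A `&` Y' @^-1` U) = \int[P]_(w in A) kap (Y w) U.

Let measurable_sub (F : Om -> \bar R) :
  measurable_fun setT (F : g_sigma_algebraType G -> \bar R) ->
  measurable_fun setT F.
Proof. by move=> mF _ U mU; apply: GO; exact: mF. Qed.

(** If [kap] gives the law of [Y'] conditionally on the sigma-algebra generated by
    [G], then [g(Y')] may be replaced by its kernel average under any weight [F]
    that depends on [G] only. The hypothesis is the case of two indicators; it
    is extended to [g] with [F] fixed, and for an indicator [g] to [F], where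
    the functional acts on the measurable space whose events are [<<s G>>]. *)
Lemma integral_kernel_step (F : Om -> R) (g : T -> \bar R) :
  (forall w, 0 <= F w)%R ->
  measurable_fun setT (F : g_sigma_algebraType G -> R) ->
  (forall z, 0 <= g z) -> measurable_fun setT g ->
  \int[P]_w ((F w)%:E * g (Y' w)) = \int[P]_w ((F w)%:E * \int[kap (Y w)]_z g z).
Proof.
move=> F0 mF g0 mg.
have mF' : measurable_fun setT F.
  by apply/measurable_EFinP; apply: measurable_sub; exact/measurable_EFinP.
have mkap U : measurable U -> measurable_fun setT (fun w => kap (Y w) U).
  by move=> mU; exact: measurableT_comp (measurable_kernel kap U mU) mY.
have kfin y U : measurable U -> kap y U \is a fin_num.
  move=> mU; rewrite ge0_fin_numE// (@le_lt_trans _ _ 1)// ?ltry//.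
  by rewrite -(@prob_kernel _ _ _ _ _ kap y) le_measure ?inE.
apply: (@eq_integral_like _ _ _ (fun g => \int[P]_w ((F w)%:E * g (Y' w)))
  (fun g => \int[P]_w ((F w)%:E * \int[kap (Y w)]_z g z))) => //.
- apply: (integral_like_mixture _ _ (fun w g => g (Y' w))) => //.
  by move=> f _ mf; exact: measurableT_comp mf mY'.
- apply: (integral_like_mixture _ _ (fun w g => \int[kap (Y w)]_z g z)) => //.
    by move=> w; exact: integral_like_integral.
  move=> f f0 mf.
  have mI : measurable_fun setT (fun y => \int[kap y]_z f z).
    by apply: measurable_fun_integral_kernel => // U mU; exact: measurable_kernel.
  exact: measurableT_comp mI mY.
move=> U mU.
have -> : \int[P]_w ((F w)%:E * \int[kap (Y w)]_z (\1_U z)%:E) =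
    \int[P]_w ((fine (kap (Y w) U))%:E * (F w)%:E).
  apply: eq_integral => w _; rewrite integral_indic// setIT fineK ?kfin//.
  by rewrite muleC.
under eq_integral do rewrite muleC.
apply: (@eq_integral_like _ (g_sigma_algebraType G) _
  (fun F => \int[P]_w ((\1_U (Y' w))%:E * F w))
  (fun F => \int[P]_w ((fine (kap (Y w) U))%:E * F w))) => //.
- apply: (@integral_like_mixture _ (g_sigma_algebraType G) R _ Om P
    (fun w => \1_U (Y' w)) (fun w F => F w)) => //.
  + have m1 : measurable_fun setT (\1_U : T -> R) by exact: measurable_indic.
    exact: measurableT_comp m1 mY'.
  + by move=> f f0 mf; exact: measurable_sub.
- apply: (@integral_like_mixture _ (g_sigma_algebraType G) R _ Om P
    (fun w => fine (kap (Y w) U)) (fun w F => F w)) => //.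
  + by apply: measurableT_comp => //; exact: mkap.
  + by move=> f f0 mf; exact: measurable_sub.
- move=> A mA; have mA' : @measurable d Om A by exact: GO.
  have -> : \int[P]_w ((\1_U (Y' w))%:E * (\1_A w)%:E) =
      \int[P]_w (\1_(A `&` Y' @^-1` U) w)%:E.
    by apply: eq_integral => w _; rewrite -EFinM indicI/= mulrC.
  rewrite integral_indic ?setIT//; last first.
    by apply: measurableI => //; rewrite -[X in measurable X]setTI; exact: mY'.
  transitivity (\int[P]_(w in A) kap (Y w) U); first exact: kapP.
  rewrite integral_mkcond; apply: eq_integral => w _.
  by rewrite fineK ?kfin// epatch_indic.
- exact/measurable_EFinP.
Qed.
End conditional_kernel.

(** * Solving the backward recursion *)

Section recursion.
Local Open Scope ereal_scope.
Context {R : realType}.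

(** This is the [q]-th power form of [x_n <= x_{n+1} + delta]. The induction
    bounds [E] at distance [k] from the end by [((k+1) delta)^q] instead of
    [(k delta)^q]: the extra unit keeps the optimal [t] away from 0 at the first
    step and only costs a factor 2 in the final constant. *)
Lemma split_recursion (q delta : R) (N : nat) (E : nat -> \bar R) :
  (1 <= q)%R -> (0 <= delta)%R -> E N = 0 ->
  (forall n t, (n < N)%N -> (0 < t < 1)%R ->
     E n <= (t * t^-1 `^ q)%:E * E n.+1
            + ((1 - t) * (1 - t)^-1 `^ q)%:E * (delta `^ q)%:E) ->
  E 0%N <= ((N.+1%:R * delta) `^ q)%:E.
Proof.
move=> q1 delta0 EN step.
suff H k : (k <= N)%N -> E (N - k)%N <= ((k.+1%:R * delta) `^ q)%:E.
  by have := H N (leqnn N); rewrite subnn.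
elim: k => [_|k IH kN]; first by rewrite subn0 EN lee_fin powR_ge0.
have {}IH := IH (ltnW kN).
(* For this [t] both terms are multiples of [((k+2) delta)^q], with total
   coefficient [t + (1 - t)]. *)
pose t : R := (k.+1%:R / k.+2%:R)%R.
have k1 : (0 < k.+1%:R :> R)%R by rewrite ltr0n.
have k2 : (0 < k.+2%:R :> R)%R by rewrite ltr0n.
have t0 : (0 < t)%R by rewrite divr_gt0.
have e2 : (k.+2%:R = k.+1%:R + 1 :> R)%R by rewrite natr1.
have te : (1 - t = k.+2%:R^-1)%R.
  by rewrite /t e2; field; rewrite gt_eqF//; lra.
have t01 : (0 < t < 1)%R by rewrite t0 -subr_gt0 te invr_gt0.
have nk : (N - k.+1 < N)%N by rewrite ltn_subrL (leq_ltn_trans _ kN).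
have := step _ t nk t01; rewrite subnSK// => /le_trans; apply.
apply: (@le_trans _ _ ((t * t^-1 `^ q)%:E * ((k.+1%:R * delta) `^ q)%:E +
    ((1 - t) * (1 - t)^-1 `^ q)%:E * (delta `^ q)%:E)).
  rewrite leeD2r// lee_wpmul2l// lee_fin mulr_ge0 ?powR_ge0//.
  exact: ltW.
have e (x y : R) : (0 <= x -> 0 <= y -> x * x^-1 `^ q * y `^ q = x * (x^-1 * y) `^ q)%R.
  by move=> x0 y0; rewrite -mulrA powRM// invr_ge0.
rewrite -!EFinM -EFinD lee_fin !e ?mulr_ge0 ?te ?invr_ge0 ?ltr0n ?(ltW t0)//.
rewrite (_ : t^-1 * _ = k.+2%:R * delta)%R; last first.
  by rewrite /t; field; rewrite !gt_eqF.
by rewrite invrK -te -mulrDl subrKC mul1r.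
Qed.
End recursion.

(** * The error on a fixed grid *)

Section one_grid.
Local Open Scope ereal_scope.
Context {R : realType} {m d : nat} {dO : measure_display}
  {Om : measurableType dO}.
Variables (P : probability Om R) (p : \bar R) (dx : 'rV[R]_m).
Variables (D : set 'rV[R]_d) (c : 'rV[R]_d -> R) (Y0 : 'rV[R]_d).
Variables (N : nat) (h eps : R) (St : nat -> set 'rV[R]_d)
  (kap : nat -> R.-pker 'rV[R]_d ~> 'rV[R]_d) (Yh : nat -> Om -> 'rV[R]_d)
  (Pi : 'rV[R]_d -> gridfun R m -> gridfun R m).
Variables (v u Rem : nat -> 'rV[int]_m -> 'rV[R]_d -> R).
Hypotheses (p1 : 1 <= p) (dx0 : forall k, (0 < dx 0%R k)%R) (h0 : (0 <= h)%R)
  (eps0 : (0 <= eps)%R).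
Hypotheses (mD : measurable D) (mc : measurable_fun D c)
  (c0 : forall y, D y -> (0 <= c y)%R).
Hypothesis chain : markov_chain P D Y0 N St kap Yh.
Hypothesis PiP : forall y, D y ->
  lp_operator p dx (Pi y) /\ op_norm p dx (Pi y) <= (1 + c y * h)%:E.
Hypotheses (wdv : scheme_well_defined p dx Pi St kap N v)
  (wdu : scheme_well_defined p dx Pi St kap N u).
Hypothesis uvN : forall i y, v N i y = u N i y.
Hypothesis uv_step : forall n i y, (n < N)%N -> St n y ->
  (`|v n i y - u n i y| <= `|scheme_expect Pi St kap n (v n.+1) i y
     - scheme_expect Pi St kap n (u n.+1) i y| + `|Rem n i y|)%R.
Hypothesis mRem : forall n i, (n < N)%N -> measurable_fun (St n) (Rem n i).
Local Notation q := (energy_exponent p).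
Hypothesis Rem_le : forall n, (n < N)%N ->
  Lnorm P q%:E (fun w => (expR (\sum_(1 <= l < n.+1) c (Yh l w) * h))%:E
    * lp_norm p dx (fun i => Rem n i (Yh n w))) <= eps%:E.

Let err n i y := (v n i y - u n i y)%R.
(** The sum starts at [l = 0], so that the growth factor of the operator at time
    [n] always takes [weight n] to [weight n.+1], at [n = 0] as well; the price
    is the constant [exp(c(Y_0) h)] in [remainder_le]. *)
Let weight n w := expR (q * \sum_(l < n) c (Yh l w) * h).
Local Notation J := (energy p dx).

Let q1 : (1 <= q)%R. Proof. exact: energy_exponent_ge1. Qed.
Let q0 : (0 < q)%R. Proof. exact: energy_exponent_gt0. Qed.

Let mSt {n} : (n <= N)%N -> measurable (St n).
Proof. by case: chain => + _ _ _ => /(_ n) H /H[]. Qed.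
Let StD {n y} : (n <= N)%N -> St n y -> D y.
Proof. by case: chain => + _ _ _ => /(_ n) H /H[_ + _ _]; apply. Qed.
Let mY {n} : (n <= N)%N -> measurable_fun setT (Yh n).
Proof. by case: chain => + _ _ _ => /(_ n) H /H[]. Qed.
Let YSt {n} w : (n <= N)%N -> St n (Yh n w).
Proof. by case: chain => + _ _ _ => /(_ n) H /H[]. Qed.
Let Yh0 w : Yh 0 w = Y0. Proof. by case: chain. Qed.

Let merr {n} i : (0 < n <= N)%N -> measurable_fun (St n) (err n i).
Proof.
by move=> nN; apply: measurable_funB; [case: wdv|case: wdu] => + _ => /(_ n nN)[_].
Qed.

(** The recursion at a fixed state [y], before averaging over the chain. *)
Let err_energy_le n y (t : R) : (n < N)%N -> St n y -> (0 < t < 1)%R ->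
  J (err n ^~ y) <= (t * t^-1 `^ q)%:E * ((expR (q * (c y * h)))%:E
      * \int[kap n y]_(z in St n.+1) J (err n.+1 ^~ z))
    + ((1 - t) * (1 - t)^-1 `^ q)%:E * J (Rem n ^~ y).
Proof.
move=> nN Sy t01; have /andP[t0 t1] := t01.
have n1N : (0 < n.+1 <= N)%N by [].
have Dy : D y by exact: StD (ltnW nN) Sy.
have [lpPi Pile] := PiP _ Dy.
have M0 : (0 <= 1 + c y * h)%R by rewrite addr_ge0// mulr_ge0// c0.
pose phi i z := (Pi y (v n.+1 ^~ z) i - Pi y (u n.+1 ^~ z) i)%R.
have iv i : (kap n y).-integrable (St n.+1) (EFin \o fun z => Pi y (v n.+1 ^~ z) i).
  by case: wdv => _ /(_ n y i nN Sy).
have iu i : (kap n y).-integrable (St n.+1) (EFin \o fun z => Pi y (u n.+1 ^~ z) i).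
  by case: wdu => _ /(_ n y i nN Sy).
have iphi i : (kap n y).-integrable (St n.+1) (EFin \o phi i).
  have := integrableB (mSt nN) (iv i) (iu i).
  by congr integrable; apply/funext => z.
have mphi i : measurable_fun (St n.+1) (phi i).
  by apply/measurable_EFinP; exact: measurable_int (iphi i).
have merr1 : measurable_fun (St n.+1) (fun z => J (err n.+1 ^~ z)).
  by apply: measurable_energy => // i; exact: merr.
have s0 : (0 < 1 - t)%R by rewrite subr_gt0.
apply: le_trans (energy_split p dx p1 dx0 t _
  (fun i => \int[kap n y]_(z in St n.+1) phi i z)%R (Rem n ^~ y) t01 _) _.
  move=> i; apply: le_trans (uv_step n i y nN Sy) _.
  rewrite lerD2r /scheme_expect -RintegralB//; exact: mSt.
rewrite leeD2r// lee_wpmul2l//.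
  by rewrite lee_fin mulr_ge0 ?powR_ge0// ltW.
apply: le_trans (energy_Rintegral p dx p1 dx0 _ phi (mSt nN) _ _ iphi) _.
  exact: prob_kernel.
have -> : (expR (q * (c y * h)))%:E * \int[kap n y]_(z in St n.+1) J (err n.+1 ^~ z)
    = \int[kap n y]_(z in St n.+1) ((expR (q * (c y * h)))%:E * J (err n.+1 ^~ z)).
  rewrite (ge0_integralZl (kap n y) (mSt nN) merr1)// => z _.
  exact: energy_ge0.
apply: ge0_le_integral; first exact: mSt.
- by move=> z _; exact: energy_ge0.
- exact: measurable_energy.
- exact: measurable_funeM.
move=> z Sz.
have lpv : in_lp p dx (v n.+1 ^~ z) by case: wdv => /(_ _ n1N)[+ _] _; apply.
have lpu : in_lp p dx (u n.+1 ^~ z) by case: wdu => /(_ _ n1N)[+ _] _; apply.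
have [_ lin] := lpPi.
have -> : phi ^~ z = Pi y (err n.+1 ^~ z).
  have := lin (-1)%R _ _ lpu lpv.
  rewrite [X in Pi y X = _ -> _](_ : _ = err n.+1 ^~ z); last first.
    by apply/funext => i; rewrite mulN1r addrC.
  by move=> ->; apply/funext => i; rewrite mulN1r addrC.
have lpe : in_lp p dx (err n.+1 ^~ z).
  exact: in_lpB.
apply: le_trans (operator_bound p dx p1 dx0 _ _ _ M0 lpPi Pile lpe) _.
rewrite lee_wpmul2r ?energy_ge0// lee_fin.
rewrite (mulrC q) expRM.
apply: ge0_ler_powR; rewrite ?nnegrE ?expR_ge0 ?(ltW q0)//.
exact: expR_ge1Dx.
Qed.

Let measurable_along d' (T' : measurableType d') n (f : 'rV[R]_d -> T') :
  (n <= N)%N -> measurable_fun (St n) f -> measurable_fun setT (f \o Yh n).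
Proof.
move=> nN mf; apply: measurable_comp (mSt nN) _ mf (mY nN).
by move=> _ [w _ <-]; exact: YSt.
Qed.

Let past n : set (set Om) :=
  [set Yh k @^-1` U | k in [set k | (k <= n)%N] & U in measurable].

Let past_measurable n : (n <= N)%N -> <<s past n >> `<=` measurable.
Proof.
move=> nN; apply: smallest_sub; first exact: sigma_algebra_measurable.
move=> _ [k kn [U mU <-]]; rewrite -[X in measurable X]setTI.
exact: (mY (leq_trans kn nN)).
Qed.

Let mc_past n l : (n < N)%N -> (l <= n)%N ->
  measurable_fun setT ((fun w => c (Yh l w) * h)%R : g_sigma_algebraType (past n) -> R).
Proof.
move=> nN ln; have lN : (l <= N)%N := leq_trans ln (ltnW nN).
apply: measurable_funM => //.
apply: (measurable_comp (mSt lN) _ (measurable_funS mD _ mc)).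
- by move=> _ [w _ <-]; exact: YSt.
- by move=> y; exact: StD.
- by move=> _ U mU; rewrite setTI; apply: sub_sigma_algebra; exists l => //; exists U.
Qed.

Let weight_past n : (n < N)%N ->
  measurable_fun setT (weight n.+1 : g_sigma_algebraType (past n) -> R).
Proof.
move=> nN; apply: (measurableT_comp (@measurable_expR R)).
apply: measurable_funM => //; apply: measurable_sum => l.
by apply: mc_past => //; rewrite -ltnS.
Qed.

Let weight_measurable n : (n < N)%N -> measurable_fun setT (weight n.+1).
Proof.
move=> nN _ U mU; apply: (past_measurable _ (ltnW nN)).
exact: (weight_past _ nN).
Qed.

Let weight_ge0 n w : (0 <= weight n w)%R. Proof. exact: expR_ge0. Qed.

(** Since [Y_0] is deterministic, [E 0] is the energy of the initial error. *)
Let E n := \int[P]_w ((weight n w)%:E * J (err n ^~ (Yh n w))).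

(** The Markov property: [weight n.+1] depends on the chain up to time [n] only,
    so the kernel average at time [n] can be undone under this weight. *)
Let energy_kernel n (nN : (n < N)%N) :
  \int[P]_w ((weight n.+1 w)%:E
     * \int[kap n (Yh n w)]_(z in St n.+1) J (err n.+1 ^~ z)) = E n.+1.
Proof.
have n1N : (0 < n.+1 <= N)%N by [].
pose g := (fun z => J (err n.+1 ^~ z)) \_ (St n.+1).
have mg : measurable_fun setT g.
  apply: (measurable_restrictT _ (mSt nN)).1.
  by apply: measurable_energy => // i; exact: merr.
have g0 z : 0 <= g z by rewrite /g /patch; case: ifP => // _; exact: energy_ge0.
have chainP : forall A, <<s past n >> A -> forall U, measurable U ->
    P (A `&` Yh n.+1 @^-1` U) = \int[P]_(w in A) kap n (Yh n w) U.
  by case: chain => _ _ _; apply.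
have := integral_kernel_step P (past n) (Yh n) (Yh n.+1) (kap n)
  (past_measurable _ (ltnW nN)) (mY (ltnW nN)) (mY nN) chainP (weight n.+1) g
  (weight_ge0 n.+1) (weight_past _ nN) g0 mg.
have -> : \int[P]_w ((weight n.+1 w)%:E * g (Yh n.+1 w)) = E n.+1.
  apply: eq_integral => w _; rewrite /g patchE mem_set//; exact: YSt.
move=> ->; apply: eq_integral => w _.
by congr (_ * _); rewrite integral_mkcond.
Qed.

Let mweight n : (n <= N)%N -> measurable_fun setT (weight n).
Proof.
case: n => [_|n nN]; last exact: weight_measurable.
by rewrite /weight; under eq_fun do rewrite big_ord0; exact: measurable_cst.
Qed.

Let merr_along n : (n <= N)%N ->
  measurable_fun setT (fun w => J (err n ^~ (Yh n w))).
Proof.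
case: n => [_|n nN].
  by under eq_fun do rewrite Yh0; exact: measurable_cst.
apply: (measurable_along _ _ n.+1 (fun y => J (err n.+1 ^~ y)) nN).
by apply: measurable_energy => // i; exact: merr.
Qed.

Let mRem_along n : (n < N)%N ->
  measurable_fun setT (fun w => J (Rem n ^~ (Yh n w))).
Proof.
move=> nN; apply: (measurable_along _ _ n (fun y => J (Rem n ^~ y)) (ltnW nN)).
by apply: measurable_energy => // i; exact: mRem.
Qed.

(** The remainder bound carries [c(Y_1) + .. + c(Y_n)] in the exponent, whereas
    [weight n] carries [c(Y_0) + .. + c(Y_{n-1})]; adding the nonnegative term
    [c(Y_n)] compares the two. *)
Let remainder_le n : (n < N)%N ->
  \int[P]_w ((weight n w)%:E * J (Rem n ^~ (Yh n w)))
    <= ((expR (c Y0 * h) * eps) `^ q)%:E.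
Proof.
move=> nN; pose s w := (\sum_(1 <= l < n.+1) c (Yh l w) * h)%R.
have ws w : (weight n w <= expR (c Y0 * h) `^ q * expR (s w) `^ q)%R.
  rewrite -!expRM -expRD ler_expR /weight -mulrDl mulrC ler_wpM2r ?(ltW q0)//.
  rewrite -[c Y0](congr1 c (Yh0 w)) /s.
  rewrite -(big_ltn (F := fun l => c (Yh l w) * h)%R)// big_mkord big_ord_recr/=.
  by rewrite lerDl mulr_ge0// c0//; apply: StD (ltnW nN) (YSt w (ltnW nN)).
have ms : measurable_fun setT (fun w => (expR (s w) `^ q)%R).
  apply: (measurableT_comp (measurable_powR q)).
  apply: (measurableT_comp (@measurable_expR R)); rewrite /s.
  under eq_fun do rewrite big_add1 big_mkord.
  apply: measurable_sum => l _ U mU.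
  by apply: (past_measurable _ (ltnW nN)); exact: mc_past.
have mJ := mRem_along _ nN.
apply: (@le_trans _ _ ((expR (c Y0 * h) `^ q)%:E *
    \int[P]_w ((expR (s w) `^ q)%:E * J (Rem n ^~ (Yh n w))))).
  rewrite -ge0_integralZl//; last 2 first.
  - by apply: emeasurable_funM => //; exact/measurable_EFinP.
  - by move=> w _; rewrite mule_ge0 ?lee_fin ?powR_ge0// energy_ge0.
  apply: ge0_le_integral => //.
  - by move=> w _; rewrite mule_ge0 ?lee_fin ?weight_ge0// energy_ge0.
  - apply: emeasurable_funM => //; apply/measurable_EFinP; exact: mweight (ltnW nN).
  - by apply: measurable_funeM; apply: emeasurable_funM => //; exact/measurable_EFinP.
  move=> w _; rewrite muleA -EFinM lee_wpmul2r ?energy_ge0// lee_fin; exact: ws.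
rewrite powRM ?expR_ge0// EFinM lee_wpmul2l ?lee_fin ?powR_ge0//.
have -> : \int[P]_w ((expR (s w) `^ q)%:E * J (Rem n ^~ (Yh n w))) =
    \int[P]_w (`| (expR (s w))%:E * lp_norm p dx (Rem n ^~ (Yh n w)) | `^ q).
  apply: eq_integral => w _; rewrite gee0_abs; last first.
    by rewrite mule_ge0 ?lp_norm_ge0 ?lee_fin ?expR_ge0.
  by rewrite poweRM ?lp_norm_ge0 ?lee_fin ?expR_ge0// -energyE// poweR_EFin.
rewrite -poweR_Lnorm ?gt_eqF// -poweR_EFin.
apply: gt0_ler_poweR; rewrite ?(ltW q0)// ?in_itv/= ?leey ?andbT ?Lnorm_ge0//.
exact: Rem_le.
Qed.

Let E_step n t : (n < N)%N -> (0 < t < 1)%R ->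
  E n <= (t * t^-1 `^ q)%:E * E n.+1 + ((1 - t) * (1 - t)^-1 `^ q)%:E
     * ((expR (c Y0 * h) * eps) `^ q)%:E.
Proof.
move=> nN t01; have /andP[t0 t1] := t01.
have s0 : (0 < 1 - t)%R by rewrite subr_gt0.
set a := (t * t^-1 `^ q)%R; set b := ((1 - t) * (1 - t)^-1 `^ q)%R.
have a0 : (0 <= a)%R by rewrite mulr_ge0 ?powR_ge0 ?ltW.
have b0 : (0 <= b)%R by rewrite mulr_ge0 ?powR_ge0 ?ltW.
pose G y := \int[kap n y]_(z in St n.+1) J (err n.+1 ^~ z).
have G0 y : 0 <= G y by apply: integral_ge0 => z _; exact: energy_ge0.
have mG : measurable_fun setT (fun w => G (Yh n w)).
  have mg : measurable_fun setT G.
    rewrite /G; under eq_fun do rewrite integral_mkcond.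
    apply: measurable_fun_integral_kernel.
    - by move=> U mU; exact: measurable_kernel.
    - by move=> z; rewrite patchE; case: ifP => // _; exact: energy_ge0.
    - apply: (measurable_restrictT _ (mSt nN)).1.
      by apply: measurable_energy => // i; exact: merr.
  exact: measurableT_comp mg (mY (ltnW nN)).
have mWG : measurable_fun setT (fun w => (weight n.+1 w)%:E * G (Yh n w)).
  by apply: emeasurable_funM => //; apply/measurable_EFinP; exact: mweight nN.
have mWR : measurable_fun setT (fun w => (weight n w)%:E * J (Rem n ^~ (Yh n w))).
  apply: emeasurable_funM; last exact: mRem_along.
  by apply/measurable_EFinP; exact: mweight (ltnW nN).
have WG0 w : 0 <= (weight n.+1 w)%:E * G (Yh n w) by rewrite mule_ge0 ?lee_fin.
have WR0 w : 0 <= (weight n w)%:E * J (Rem n ^~ (Yh n w)).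
  by rewrite mule_ge0 ?lee_fin ?energy_ge0.
apply: (@le_trans _ _ (\int[P]_w (a%:E * ((weight n.+1 w)%:E * G (Yh n w)) +
    b%:E * ((weight n w)%:E * J (Rem n ^~ (Yh n w)))))).
  apply: ge0_le_integral => //.
  - by move=> w _; rewrite mule_ge0 ?lee_fin ?energy_ge0.
  - apply: emeasurable_funM; last exact: merr_along (ltnW nN).
    by apply/measurable_EFinP; exact: mweight (ltnW nN).
  - by apply: emeasurable_funD; exact: measurable_funeM.
  move=> w _.
  have W0 : 0 <= (weight n w)%:E by rewrite lee_fin.
  have := err_energy_le _ _ _ nN (YSt w (ltnW nN)) t01.
  move=> /(lee_wpmul2l W0)/le_trans; apply.
  rewrite ge0_muleDr ?mule_ge0 ?lee_fin ?expR_ge0 ?energy_ge0//; last exact: G0.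
  rewrite -/a -/b -/(G _) [leLHS](_ : _ = a%:E * ((weight n.+1 w)%:E * G (Yh n w)) +
    b%:E * ((weight n w)%:E * J (Rem n ^~ (Yh n w))))//.
  rewrite !(muleCA (weight n w)%:E); congr (_ * _ + _).
  by rewrite muleA -EFinM -expRD -mulrDr /weight big_ord_recr/= addrC.
rewrite ge0_integralD//; last 4 first.
- by move=> w _; rewrite mule_ge0.
- exact: measurable_funeM.
- by move=> w _; rewrite mule_ge0.
- exact: measurable_funeM.
rewrite !ge0_integralZl// energy_kernel// leeD2l// lee_wpmul2l//.
exact: remainder_le.
Qed.

Lemma grid_error_bound :
  lp_norm p dx (fun i => v 0 i Y0 - u 0 i Y0)%R
    <= (N.+1%:R * (expR (c Y0 * h) * eps))%:E.
Proof.
have EN : E N = 0.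
  rewrite /E; apply: integral0_eq => w _.
  have -> : err N ^~ (Yh N w) = (fun i => 0 * 0)%R.
    by apply/funext => i; rewrite /err uvN subrr mul0r.
  by rewrite (energyZ p dx p1 dx0 0%R (fun=> 0%R))// powR0 ?gt_eqF// mul0e mule0.
have d0 : (0 <= expR (c Y0 * h) * eps)%R by rewrite mulr_ge0 ?expR_ge0.
have := split_recursion q _ N E q1 d0 EN E_step.
have -> : E 0%N = J (fun i => v 0 i Y0 - u 0 i Y0)%R.
  rewrite /E; under eq_integral do rewrite Yh0 /weight big_ord0 mulr0 expR0 mul1e.
  rewrite integral_cst// [X in _ * X](_ : _ = 1) ?mule1//; exact: probability_setT.
rewrite -poweR_EFin => le.
rewrite lp_normE//; have := @gt0_ler_poweR R (q^-1)%R _ _ _ _ _ le.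
rewrite -poweRrM mulfV ?gt_eqF// poweRe1 ?lee_fin ?mulr_ge0//; apply.
- by rewrite invr_ge0 ltW.
- by rewrite in_itv/= leey andbT energy_ge0.
- by rewrite in_itv/= leey andbT lee_fin powR_ge0.
Qed.

End one_grid.

(** * The two schemes *)

Section schemes.
Context {R : realType}.

Lemma measurable_convex_domain {d} (D : set 'rV[R]_d) :
  convex_domain_or_closure D -> measurable D.
Proof.
have open_m (U : set 'rV[R]_d) : open U -> measurable U.
  exact: sub_sigma_algebra.
move=> [U [oU _ _ [->|->]]]; first exact: open_m.
rewrite -[closure U]setCK; apply: measurableC; apply: open_m.
by rewrite openC; exact: closed_closure.
Qed.

Lemma ler_dist_maxr (a b c : R) : `|Num.max a b - Num.max a c| <= `|b - c|.
Proof.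
rewrite /Num.max; case: ltP => ab; case: ltP => ac //.
- by rewrite !ger0_norm; lra.
- by rewrite !ler0_norm; lra.
- by rewrite subrr normr0.
Qed.

Lemma backward_last {A : Type} (step : nat -> A -> A) (N : nat) (v : A) :
  backward step N N v = v.
Proof. by rewrite /backward subnn. Qed.

Lemma backward_step {A : Type} (step : nat -> A -> A) (N n : nat) (v : A) :
  (n < N)%N -> backward step N n v = step n (backward step N n.+1 v).
Proof.
move=> nN; rewrite /backward -(subnSK nN) /=; congr step.
by rewrite subnSK// subKn// ltnW.
Qed.
Lemma utilde_step {m d lB lW lH : nat}
    (S : R -> 'rV[R]_m -> 'rV[R]_d -> setup R m d lB lW lH) (T : R)
    (f g : 'rV[R]_m -> 'rV[R]_d -> R) (N n : nat) x y : (n < N)%N ->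
  utilde S T f g N n x y = Num.max (g x y)
    (expect S (n%:R * (T / N%:R)) (n.+1%:R * (T / N%:R)) (utilde S T f g N n.+1) x y).
Proof. by move=> nN; rewrite {1}/utilde backward_step. Qed.

Lemma uscheme_step {m d : nat} (f g : 'rV[R]_m -> 'rV[R]_d -> R) X0 dx Pi St kap
    (N n : nat) i y : (n < N)%N ->
  uscheme f g X0 dx Pi St kap N n i y = Num.max (g (grid X0 dx i) y)
    (scheme_expect Pi St kap n (uscheme f g X0 dx Pi St kap N n.+1) i y).
Proof. by move=> nN; rewrite {1}/uscheme backward_step. Qed.
End schemes.

Theorem theorem4p4p1 (R : realType) (m d lB lW lH : nat)
    (D : set 'rV[R]_d) (T : R)
    (f g : 'rV[R]_m -> 'rV[R]_d -> R)
    (M : coefficients R m d lB lW lH)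
    (S : R -> 'rV[R]_m -> 'rV[R]_d -> setup R m d lB lW lH)
    (X0 : 'rV[R]_m) (Y0 : 'rV[R]_d)
    (St : nat -> nat -> set 'rV[R]_d)
    (kap : nat -> nat -> R.-pker 'rV[R]_d ~> 'rV[R]_d)
    (Yh : nat -> nat -> Omega (S 0 X0 Y0) -> 'rV[R]_d)
    (Pi : nat -> 'rV[R]_m -> 'rV[R]_d -> gridfun R m -> gridfun R m)
    (p : \bar R) (c : 'rV[R]_d -> R) (Err : R -> 'rV[R]_m -> R)
    (m_gt0 : (0 < m)%N) (d_gt0 : (0 < d)%N) (T_gt0 : 0 < T) (DY0 : D Y0)
    (HS : standing_assumptions M D T f S)
    (Hchain : forall N, (0 < N)%N ->
       markov_chain (Pr (S 0 X0 Y0)) D Y0 N (St N) (kap N) (Yh N))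
    (Hindep : forall N, (0 < N)%N ->
       independent (Pr (S 0 X0 Y0))
         (sigma_proc [set n | (n <= N)%N] (Yh N))
         (sigma_proc [set s : R | 0 <= s]
            (fun (s : R) w => (Bm (S 0 X0 Y0) s w,
                         compound (Kp (S 0 X0 Y0)) (Jp (S 0 X0 Y0)) s w))))
    (Hg : g = (fun _ _ => 0) \/ g = f)
    (Hut : forall N, (0 < N)%N -> utilde_well_defined S T f g D N)
    (HB : assumption_B S T f g D X0 (Pr (S 0 X0 Y0)) St kap Yh Pi p c Err)
    (Hu : forall N (dx : 'rV[R]_m), (0 < N)%N -> (forall k, 0 < dx 0 k) ->
       scheme_well_defined p dx (Pi N dx) (St N) (kap N) N
         (uscheme f g X0 dx (Pi N dx) (St N) (kap N) N)) :
  exists hbar C : R, [/\ 0 < hbar < 1, 0 < C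
    & forall (N : nat) (dx : 'rV[R]_m), (0 < N)%N -> T / N%:R < hbar ->
        (forall k, 0 < dx 0 k) -> enorm dx < 1 ->
        (lp_norm p dx (fun i =>
           utilde S T f g N 0 (grid X0 dx i) Y0
           - uscheme f g X0 dx (Pi N dx) (St N) (kap N) N 0 i Y0)%R
         <= (C * T * Err (T / N%:R) dx)%:E)%E].
Proof.
have [[p1 mc c0 Err0 _] HPi Hv [Rem [RemE mRem [hb [C [hb01 C0 Rem_le]]]]]] := HB.
have [hb0 hb1] := andP hb01.
exists hb, (2 * expR (c Y0) * C); split=> //; first by rewrite !mulr_gt0 ?expR_gt0.
move=> N dx N0 hlt dx0 dx1; set h := T / N%:R.
have NR : 0 < N%:R :> R by rewrite ltr0n.
have h0 : 0 < h by rewrite divr_gt0.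
have eps0 : 0 <= C * h * Err h dx by rewrite !mulr_ge0 ?Err0// ltW.
have mD : measurable D by apply: measurable_convex_domain; case: HS.
pose v n i y := utilde S T f g N n (grid X0 dx i) y.
pose u := uscheme f g X0 dx (Pi N dx) (St N) (kap N) N.
have uvN i y : v N i y = u N i y by rewrite /v /u /utilde /uscheme !backward_last.
(* The obstacle disappears: both values are maxima with the same [g]. *)
have uv_step n i y : (n < N)%N -> St N n y ->
    `|v n i y - u n i y| <= `|scheme_expect (Pi N dx) (St N) (kap N) n (v n.+1) i y
     - scheme_expect (Pi N dx) (St N) (kap N) n (u n.+1) i y| + `|Rem N dx n i y|.
  move=> nN Sy; rewrite {1}/v {1}/u utilde_step// uscheme_step//.
  apply: le_trans (ler_dist_maxr _ _ _) _.
  rewrite -/h -/u; have -> := RemE N dx n i y N0 dx0 nN Sy.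
  set a := expect _ _ _ _ _ _; set b := scheme_expect _ _ _ _ _ _ _.
  rewrite (_ : a - b = (a + Rem N dx n i y - b) - Rem N dx n i y); last by ring.
  exact: ler_normB.
have le := grid_error_bound (Pr (S 0 X0 Y0)) p dx D c Y0 N h (C * h * Err h dx)
  (St N) (kap N) (Yh N) (Pi N dx) v u (Rem N dx) p1 dx0 (ltW h0) eps0 mD mc c0
  (Hchain N N0) (fun y => HPi N dx y N0 dx0) (Hv N dx N0 dx0) (Hu N dx N0 dx0)
  uvN uv_step (fun n i => mRem N dx n i N0 dx0) _.
apply: le_trans (le _) _.
  move=> n nN; have := Rem_le N dx n N0 hlt dx0 dx1 nN.
  have -> : (if p == +oo then 1 else p)%E = (energy_exponent p)%:E by case: (p) p1.
  by [].
rewrite lee_fin (_ : 2 * expR (c Y0) * C * T * Err h dx =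
  (2 * N%:R) * (expR (c Y0) * (C * h * Err h dx))); last first.
  by rewrite /h; field; rewrite gt_eqF.
apply: ler_pM; first exact: ler0n.
- by rewrite mulr_ge0 ?expR_ge0.
- have N1 : 1 <= N%:R :> R by rewrite ler1n.
  by rewrite -natr1; lra.
rewrite ler_wpM2r// ler_expR -[leRHS]mulr1 ler_wpM2l ?c0// ltW//.
exact: lt_trans hb1.
Qed.
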